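(* Let $G$ be a finite group of order $n$, let $m\le n/3$ be a nonnegative integer and $\varepsilon\ge0$ real. Let $\rho=\rho_1\otimes\cdots\otimes\rho_n$ be an $m$-sparse irreducible representation of $G^n$, and suppose that for every one-dimensional representation $\rho_0$ of $G$ of order two, the number of $i\in\operatorname{supp}\rho$ with $\rho_i\cong\rho_0$ is at most $(1-\varepsilon)m$. Then \[ \|\widehat{1_S}(\rho)\|_{\mathrm{op}}\le 0.99^{\varepsilon m}\binom{n}{m}^{-1/2}\frac{n!}{n^n}. \]
   Context: All representations are finite-dimensional unitary complex representations. The irreducible representations of $G^n$ are (up to isomorphism) the $\rho=\rho_1\otimes\cdots\otimes\rho_n$ with $\rho_i$ irreducible representations of $G$, acting by $\rho(g_1,\dots,g_n)=\rho_1(g_1)\otimes\cdots\otimes\rho_n(g_n)$. $\operatorname{supp}\rho=\{i:\rho_i\text{ nontrivial}\}$, and $\rho$ is $m$-sparse if $|\operatorname{supp}\rho|=m$. $S\subset G^n$ is the set of $n$-tuples with pairwise distinct entries, and $\widehat{1_S}(\rho)=n^{-n}\sum_{x\in S}\rho(x)$. A one-dimensional representation $\rho_0$ has order two if $\rho_0$ is nontrivial and $\rho_0^2$ is trivial. $\|\cdot\|_{\mathrm{op}}$ is the operator norm.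
   Formalization: The formal theorem additionally assumes ε ≤ 1 when m > 0; without it the claim fails for groups with no one-dimensional representation of order two (e.g. G = Z/7, m = 2, ρ = χ⊗χ⁻¹⊗1⊗⋯⊗1, ε large). *)

(* Defs.v *)
From HB Require Import structures.
From mathcomp Require Import all_boot all_order all_algebra all_fingroup.
From mathcomp Require Import mxrepresentation spectral complex.
From mathcomp Require Import boolp classical_sets reals exp.

Set Implicit Arguments.
Unset Strict Implicit.
Unset Printing Implicit Defensive.

Import Order.TTheory GRing.Theory Num.Theory.

Local Open Scope ring_scope.

(* G^n as a finite group, with the componentwise law of gproduct. *)
Definition power_group (gT : finGroupType) (n : nat) : finGroupType :=
  {dffun forall i : 'I_n, gT}.

Definition distinct_tuples (gT : finGroupType) (n : nat) :
    {set power_group gT n} :=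
  [set x : {dffun forall i : 'I_n, gT} | injectiveb x]%SET.

Section Representations.

Variables (F : fieldType) (gT : finGroupType).

Local Notation repr d := (mx_representation F [set: gT]%G d).

Lemma triv_mx_repr : mx_repr [set: gT] (fun _ : gT => 1%:M : 'M[F]_1).
Proof. by split=> // x y _ _; rewrite mulmx1. Qed.

Definition triv_repr : repr 1 := MxRepresentation triv_mx_repr.

Definition nontrivial_repr d (rho : repr d) : Prop := ~ mx_rsim rho triv_repr.

(* A one-dimensional representation of order two; the square of a
   one-dimensional representation is taken pointwise, in the ring 'M_1. *)
Definition order_two_repr (rho0 : repr 1) : Prop :=
  nontrivial_repr rho0 /\ forall g : gT, rho0 g ^+ 2 = 1.

Section TensorProduct.

Variables (n : nat) (d : 'I_n -> nat) (rho : forall i, repr (d i)).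

(* The space of rho_1 (x) ... (x) rho_n has as basis the pure tensors
   e_(a 1) (x) ... (x) e_(a n), indexed by the choices a of one basis index in
   each factor; the matrix below is the n-fold Kronecker product. *)
Definition tensor_index : finType := {dffun forall i : 'I_n, 'I_(d i)}.

Definition tensor_dim : nat := #|{: tensor_index}|.

Definition tensor_mx (x : power_group gT n) : 'M[F]_tensor_dim :=
  \matrix_(a, b) \prod_(i < n)
    rho i (x i) ((enum_val a : tensor_index) i) ((enum_val b : tensor_index) i).

Lemma sum_tensor_index (f : forall i, 'I_(d i) -> F) :
  \sum_(a : tensor_index) \prod_i f i (a i) = \prod_i \sum_j f i j.
Proof.
rewrite (reindex (@dffun_of_fprod _ (fun i => 'I_(d i)))); last first.
  by apply: onW_bij; exact: dffun_of_fprod_bij.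
transitivity (\sum_(t : fprod (fun i => 'I_(d i))) \prod_(i in 'I_n)
    [ffun j => f i j] (t i)).
  by apply: eq_bigr => t _; apply: eq_bigr => i _; rewrite !ffunE.
rewrite big_fprod; rewrite [RHS](eq_bigr (fun i : 'I_n =>
    \sum_(u in tagged_with (fun i => 'I_(d i)) i) untag 0 (f i) u)); last first.
  by move=> i _; exact: (big_tag (T_ := fun i => 'I_(d i)) f).
rewrite bigA_distr_big_dep; apply: eq_bigr => g _; apply: eq_bigr => i _.
by rewrite /untag; case: eqP => // e; rewrite ffunE.
Qed.

Lemma tensor_mx_repr : mx_repr [set: power_group gT n] tensor_mx.
Proof.
split=> [|x y _ _]; apply/matrixP=> a b; rewrite !mxE.
  have [<-|neq_ab] := eqVneq a b.
    by apply: big1 => i _; rewrite ffunE repr_mx1 mxE eqxx.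
  have [i ne_i] : exists i,
      (enum_val a : tensor_index) i != (enum_val b : tensor_index) i.
    apply/existsP; apply: contraR neq_ab; rewrite negb_exists.
    move=> /forallP eq_ab; apply/eqP/enum_val_inj/ffunP => i.
    by apply/eqP; move: (eq_ab i); rewrite negbK.
  by rewrite (bigD1 i) //= ffunE repr_mx1 mxE (negPf ne_i) mul0r.
under [RHS]eq_bigr => c _ do rewrite !mxE -big_split /=.
under [LHS]eq_bigr => i _ do rewrite ffunE repr_mxM ?inE // mxE.
rewrite -sum_tensor_index (reindex (fun c : 'I_tensor_dim => enum_val c)) //.
by apply: onW_bij; exact: enum_val_bij.
Qed.

Definition tensor_repr :
    mx_representation F [set: power_group gT n]%G tensor_dim :=
  MxRepresentation tensor_mx_repr.

Definition supp_repr : {set 'I_n} :=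
  [set i | `[< nontrivial_repr (rho i) >]]%SET.

End TensorProduct.

End Representations.

Definition unitary_repr (C : numClosedFieldType) (gT : finGroupType)
    (G : {group gT}) (d : nat) (rho : mx_representation C G d) : Prop :=
  forall g, g \in G -> rho g \is unitarymx.

Definition fourier_distinct (C : numClosedFieldType) (gT : finGroupType)
    (n D : nat) (rho : mx_representation C [set: power_group gT n]%G D) :
    'M[C]_D :=
  (n%:R ^- n) *: \sum_(x in distinct_tuples gT n) rho x.

Definition l2norm (R : realType) (k : nat) (v : 'cV[R[i]]_k) : R :=
  Num.sqrt (\sum_(j < k) Normc.normc (v j 0) ^+ 2).

Definition opnorm (R : realType) (k l : nat) (A : 'M[R[i]]_(k, l)) : R :=
  sup [set l2norm (A *m v) | v in [set v | l2norm v <= 1]]%classic.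

(* Main.v *)
(* The n slots of the tensor product are commuting unitary representations of G
   on one space; write T for the sum over injective tuples.  In a slot t without
   invariants the sum over all of G vanishes, so the last entry of an injective
   tuple may be replaced by minus the entries it has to avoid: T is minus a sum,
   over the other slots a, of the same operator for the merged slot a t.  On the
   invariants of a t the number of slots drops by two, on their complement by
   one, and the latter contribution is smaller by about (m / (n - m))^(1/2).
   Without the order two condition this recursion gives the bound with eps = 0.

   To gain the constant factor per step, bound the sum of the projections P_a
   onto the invariants of a t.  After splitting into pieces on which all class
   averages act by scalars, P_a P_b P_a = c P_a with 1 / c an integer, the
   dimension squared of the irreducible constituent of t.  Either c <= 1/2 for
   some slot, and the P_a overlap little, or all slots act by characters; then
   some slot is dual to at most half of the slots, unless all of them are one
   and the same character of order two. *)

Require Import Defs.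
From mathcomp Require Import all_boot all_order all_algebra all_fingroup.
From mathcomp Require Import mxrepresentation spectral complex.
From mathcomp Require Import boolp classical_sets reals exp.
From mathcomp Require Import sesquilinear ring lra zify.

Set Implicit Arguments.
Unset Strict Implicit.
Unset Printing Implicit Defensive.

Import Order.TTheory GRing.Theory Num.Theory.

Local Open Scope ring_scope.
Local Open Scope sesquilinear_scope.

(** * Real inner products of complex row vectors *)

Section RealInnerProduct.

Variable R : rcfType.
Local Notation C := R[i].

(** Vectors are rows and operators act on the right. The real part suffices, since only norms and
    their polarisations are estimated. *)
Definition rdot D (u v : 'rV[C]_D) : R := complex.Re ((u *m v ^t*) 0 0).

Definition sqnorm D (u : 'rV[C]_D) : R := rdot u u.

Variable D : nat.
Implicit Types (u v w : 'rV[C]_D) (A B : 'M[C]_D).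

Lemma rdotE u v : rdot u v = \sum_j
  (complex.Re (u 0 j) * complex.Re (v 0 j)
   + complex.Im (u 0 j) * complex.Im (v 0 j)).
Proof.
rewrite /rdot mxE raddf_sum; apply: eq_bigr => j _; rewrite !mxE /=.
by case: (u 0 j) (v 0 j) => [a b] [c e] /=; rewrite mulrN opprK.
Qed.

Lemma rdotC u v : rdot u v = rdot v u.
Proof. by rewrite !rdotE; apply: eq_bigr => j _; congr (_ + _); apply: mulrC. Qed.

Lemma rdotDl u v w : rdot (u + v) w = rdot u w + rdot v w.
Proof. by rewrite /rdot mulmxDl mxE raddfD. Qed.

Lemma rdotNl u v : rdot (- u) v = - rdot u v.
Proof. by rewrite /rdot mulNmx mxE raddfN. Qed.

Lemma rdot0l v : rdot 0 v = 0.
Proof. by rewrite /rdot mul0mx mxE. Qed.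

Lemma rdotZl (a : R) u v : rdot (a%:C%C *: u) v = a * rdot u v.
Proof.
rewrite /rdot -scalemxAl mxE; case: ((u *m _) 0 0) => x y /=.
by rewrite mul0r subr0.
Qed.

Lemma rdot_suml (I : finType) (P : pred I) (F : I -> 'rV[C]_D) v :
  rdot (\sum_(i | P i) F i) v = \sum_(i | P i) rdot (F i) v.
Proof.
apply: (big_morph (fun u => rdot u v)) => [x y|]; first exact: rdotDl.
exact: rdot0l.
Qed.

Lemma rdot_sumr (I : finType) (P : pred I) (F : I -> 'rV[C]_D) v :
  rdot v (\sum_(i | P i) F i) = \sum_(i | P i) rdot v (F i).
Proof. by rewrite rdotC rdot_suml; apply: eq_bigr => i _; rewrite rdotC. Qed.

Lemma rdot_adjoint u v A : rdot (u *m A) v = rdot u (v *m A ^t*).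
Proof.
by rewrite /rdot trmx_mul map_mxM trmxCK mulmxA.
Qed.

Lemma sqnorm_ge0 u : 0 <= sqnorm u.
Proof.
by rewrite /sqnorm rdotE sumr_ge0 // => j _; rewrite -!expr2 addr_ge0 ?sqr_ge0.
Qed.

Lemma sqnorm0 : sqnorm (0 : 'rV[C]_D) = 0.
Proof. exact: rdot0l. Qed.

Lemma sqnormN u : sqnorm (- u) = sqnorm u.
Proof. by rewrite /sqnorm rdotNl rdotC rdotNl opprK. Qed.

Lemma sqnormZ (a : R) u : sqnorm (a%:C%C *: u) = a ^+ 2 * sqnorm u.
Proof. by rewrite /sqnorm rdotZl rdotC rdotZl mulrA. Qed.

Lemma sqnormD u v : sqnorm (u + v) = sqnorm u + sqnorm v + 2 * rdot u v.
Proof.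
by rewrite /sqnorm rdotDl !(rdotC _ (u + v)) !rdotDl (rdotC v u); ring.
Qed.

(** The inequality of means with a free weight: expand the squared norm of [t u - v] and divide by
    [t]. *)
Lemma rdot_le u v (t : R) : 0 < t ->
  2 * rdot u v <= t * sqnorm u + t^-1 * sqnorm v.
Proof.
move=> t0; have tV0 : 0 <= t^-1 by rewrite invr_ge0 ltW.
have := mulr_ge0 tV0 (sqnorm_ge0 (t%:C%C *: u - v)).
rewrite sqnormD sqnormN sqnormZ rdotZl (rdotC u) rdotNl (rdotC v u).
have -> : t^-1 * (t ^+ 2 * sqnorm u + sqnorm v + 2 * (t * - rdot u v))
  = t * sqnorm u + t^-1 * sqnorm v - 2 * rdot u v.
  by field; rewrite gt_eqF.
by rewrite subr_ge0.
Qed.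

(** Cauchy-Schwarz: each cross term is at most the mean of two squared norms. *)
Lemma sqnorm_sum (I : finType) (F : I -> 'rV[C]_D) :
  sqnorm (\sum_i F i) <= #|I|%:R * \sum_i sqnorm (F i).
Proof.
rewrite /sqnorm rdot_suml.
under eq_bigr do rewrite rdot_sumr.
have h i j : rdot (F i) (F j) <= 2^-1 * (sqnorm (F i) + sqnorm (F j)).
  by have := rdot_le (F i) (F j) ltr01; rewrite invr1 !mul1r; lra.
apply: (le_trans (ler_sum _ (fun i _ => ler_sum _ (fun j _ => h i j)))).
under eq_bigr do rewrite -mulr_sumr big_split /=.
rewrite -mulr_sumr big_split /= [X in _ + X]exchange_big /= -mulr2n.
under eq_bigr do rewrite sumr_const.
rewrite -[X in _ * X]mulr_natl mulrA mulVf ?mul1r ?pnatr_eq0 //.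
by rewrite sumrMnl mulr_natl.
Qed.

Lemma rdot_herm_proj A u v : A ^t* = A -> A *m A = A ->
  rdot (u *m A) v = rdot (u *m A) (v *m A).
Proof. by move=> hA iA; rewrite -{1}iA mulmxA rdot_adjoint hA. Qed.

Lemma sqnorm_herm_proj A u : A ^t* = A -> A *m A = A ->
  sqnorm u = sqnorm (u *m A) + sqnorm (u - u *m A).
Proof.
move=> hA iA; have e : rdot (u *m A) (u - u *m A) = 0.
  by rewrite (rdot_herm_proj _ _ hA iA) mulmxBl -mulmxA iA subrr rdotC rdot0l.
have := sqnormD (u *m A) (u - u *m A).
by rewrite addrC subrK e mulr0 addr0.
Qed.

End RealInnerProduct.

(** * Sums over injective tuples *)

Section CommutingFamilies.

Variables (F : fieldType) (gT : finGroupType) (D : nat).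
Local Notation opfun := {ffun gT -> 'M[F]_D}.
Implicit Types (s : seq opfun) (t a b : opfun) (X : {set gT}).

(* Slots act on one common space, so that merging two slots of a tensor product
   is again a pointwise product of commuting families. *)
(* Locked: unification otherwise compares whole families pointwise. *)
Definition commuting a b : bool :=
  locked [forall g, forall h, a g *m b h == b h *m a g].

Definition slot_mul a b : opfun := locked [ffun g => a g *m b g].

Definition delete (T : Type) (s : seq T) j := take j s ++ drop j.+1 s.

(** [X] records the values already taken, so that distinctness is enforced one slot at a time. *)
Fixpoint injsum s X : 'M[F]_D :=
  if s is t :: s' then \sum_(x | x \notin X) t x *m injsum s' (x |: X) else 1%:M.

Lemma commutingP a b :
  reflect (forall g h, a g *m b h = b h *m a g) (commuting a b).
Proof.
rewrite /commuting -lock; apply: (iffP forallP) => [h g g' | h g].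
  by have /forallP/(_ g')/eqP := h g.
by apply/forallP => g'; rewrite h.
Qed.

Lemma slot_mulE a b g : slot_mul a b g = a g *m b g.
Proof. by rewrite /slot_mul -lock ffunE. Qed.

Lemma commuting_sym : symmetric commuting.
Proof. by move=> a b; apply/commutingP/commutingP => h g g'; rewrite h. Qed.

Lemma commuting_slot_mul a b c : commuting a c -> commuting b c ->
  commuting (slot_mul a b) c.
Proof.
move=> /commutingP ac /commutingP bc; apply/commutingP => g h.
by rewrite slot_mulE -mulmxA bc mulmxA ac mulmxA.
Qed.

Lemma comm_injsum s X (A : 'M_D) :
  {in s, forall t g, t g *m A = A *m t g} -> injsum s X *m A = A *m injsum s X.
Proof.
elim: s X => [|t s IH] X h /=; first by rewrite mul1mx mulmx1.
rewrite mulmx_suml mulmx_sumr; apply: eq_bigr => x _.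
rewrite -mulmxA IH ?mulmxA ?h ?mem_head // => t' t's g.
by rewrite h // in_cons t's orbT.
Qed.

Lemma injsum_swap a b s X : commuting a b ->
  injsum [:: a, b & s] X = injsum [:: b, a & s] X.
Proof.
move=> /commutingP ab /=.
under eq_bigr do rewrite mulmx_sumr.
under [RHS]eq_bigr do rewrite mulmx_sumr.
rewrite (exchange_big_dep (fun y => y \notin X)) /=; last first.
  by move=> x y _; rewrite !inE negb_or => /andP[].
apply: eq_bigr => y yX; apply: eq_big => [x | x _].
  by rewrite !inE !negb_or yX andbT eq_sym andbC.
by rewrite !mulmxA ab finset.setUCA.
Qed.

Lemma injsum_cons t s s' X : (forall Y, injsum s Y = injsum s' Y) ->
  injsum (t :: s) X = injsum (t :: s') X.
Proof. by move=> h /=; under eq_bigr do rewrite h. Qed.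

Lemma injsum_front s1 t s2 X : all (commuting t) s1 ->
  injsum (s1 ++ t :: s2) X = injsum (t :: s1 ++ s2) X.
Proof.
elim: s1 X => //= a s1 IH X /andP[ta ts1].
rewrite -/(injsum (a :: s1 ++ t :: s2) X) -/(injsum [:: t, a & s1 ++ s2] X).
rewrite injsum_swap //.
by apply: injsum_cons => Y; rewrite IH.
Qed.

(* The entry of the first slot may be any element outside X except for the
   values taken by the other slots; each exclusion merges two slots. *)
Lemma injsum_merge t s X : all (commuting t) s -> pairwise commuting s ->
  injsum (t :: s) X = (\sum_(x | x \notin X) t x) *m injsum s X
    - \sum_(j < size s) injsum (slot_mul (nth t s j) t :: delete s j) X.
Proof.
elim: s X => [|a s IH] X /=.
  by rewrite big_ord0 subr0 mulmx_suml.
move=> /andP[ta ts] /andP[as_ ss].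
have /commutingP ta' := ta.
rewrite -/(injsum [:: t, a & s] X) injsum_swap //=.
rewrite big_ord_recl /= opprD addrA.
rewrite -/(injsum (slot_mul a t :: delete (a :: s) 0) X).
set S := \sum_(x | x \notin X) t x.
have aS x : a x *m S = S *m a x.
  by rewrite mulmx_suml mulmx_sumr; apply: eq_bigr => y _; rewrite ta'.
(* The induction hypothesis sums [t] outside [x |: X]. Restoring the missing [t x] gives [S], and
   the correction is the merge of [t] with [a]. *)
transitivity (\sum_(x | x \notin X) (S *m (a x *m injsum s (x |: X))
  - slot_mul a t x *m injsum s (x |: X)
  - \sum_(j < size s)
      a x *m injsum (slot_mul (nth t s j) t :: delete s j) (x |: X))).
  apply: eq_bigr => x xX.
  rewrite -/(injsum (t :: s) (x |: X)) IH // mulmxBr mulmxA mulmx_sumr.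
  congr (_ - _); rewrite mulmxA -aS -mulmxBl slot_mulE -mulmxBr; congr (_ *m _ *m _).
  rewrite /S [in RHS](bigD1 x) //= addrC addrK; apply: eq_bigl => y.
  by rewrite !inE negb_or andbC.
rewrite !sumrB -mulmx_sumr; congr (_ - _ - _).
  by rewrite /delete /= drop0.
rewrite exchange_big; apply: eq_bigr => j _ /=.
rewrite -/(delete (a :: s) _) -/(injsum (slot_mul (nth t s j) t :: a :: delete s j) X).
rewrite -/(injsum (slot_mul (nth t s j) t :: delete (a :: s) j.+1) X).
rewrite [RHS]injsum_swap //.
have sj : nth t s j \in s by rewrite mem_nth.
by apply: commuting_slot_mul; rewrite // commuting_sym ?(allP as_).
Qed.

End CommutingFamilies.

Section TrivialSlot.

Variables (F : fieldType) (gT : finGroupType) (D : nat).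
Local Notation opfun := {ffun gT -> 'M[F]_D}.
Implicit Types (s : seq opfun) (t a b : opfun) (X : {set gT}).

Lemma delete_split (T : Type) (s : seq T) j (t0 : T) : (j < size s)%N ->
  s = take j s ++ nth t0 s j :: drop j.+1 s.
Proof. by move=> js; rewrite -drop_nth // cat_take_drop. Qed.

Lemma size_delete (T : Type) (s : seq T) j : (j < size s)%N ->
  size (delete s j) = (size s).-1.
Proof. by move=> js; rewrite size_cat size_take size_drop js; lia. Qed.

Lemma perm_delete (T : eqType) (s : seq T) j (t0 : T) : (j < size s)%N ->
  perm_eq s (nth t0 s j :: delete s j).
Proof. by move=> js; rewrite {1}(delete_split t0 js) -cat1s perm_catCA. Qed.

Lemma perm_pairwise_commuting s s' : perm_eq s s' ->
  pairwise (@commuting F gT D) s = pairwise (@commuting F gT D) s'.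
Proof.
have key s1 s2 : perm_eq s1 s2 ->
    pairwise (@commuting F gT D) s1 -> pairwise (@commuting F gT D) s2.
  elim: s2 s1 => [|a s2 IH] s1 // e p1.
  have as1 : a \in s1 by rewrite (perm_mem e) mem_head.
  case/splitPr: as1 e p1 => p1 p2 e.
  have e' : perm_eq (p1 ++ p2) s2.
    by rewrite -(perm_cons a); apply: perm_trans e; rewrite -cat1s perm_sym -cat1s perm_catCA.
  rewrite pairwise_cat allrel_consr pairwise_cons.
  move=> /and3P[/andP[h1 h2] h3 /andP[h4 h5]] /=.
  rewrite (IH _ e') ?pairwise_cat ?h2 ?h3 ?h5 // andbT.
  rewrite -(perm_all _ e') all_cat h4 andbT.
  by apply/allP => x xp; rewrite commuting_sym (allP h1).
by move=> e; apply/idP/idP; apply: key; rewrite // perm_sym.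
Qed.

Lemma injsum_delete s j t0 X : (j < size s)%N ->
  pairwise (@commuting F gT D) s ->
  injsum s X = injsum (nth t0 s j :: delete s j) X.
Proof.
move=> js; rewrite {1 2}(delete_split t0 js) pairwise_cat allrel_consr.
move=> /andP[/andP[h _] _]; rewrite injsum_front //.
by apply/allP => x xs; rewrite commuting_sym (allP h).
Qed.

(** As [t] fixes [u], a merged slot acts on [u] like the slot it came from, so every merged term of
    [injsum_merge] becomes [u *m injsum s X]. The scalar counts the values left free by the other
    slots. *)
Lemma injsum_trivial k (u : 'M_(k, D)) t s X :
  all (commuting t) s -> pairwise (@commuting F gT D) s ->
  (forall g, u *m t g = u) ->
  u *m injsum (t :: s) X = (#|~: X|%:R - (size s)%:R) *: (u *m injsum s X).
Proof.
move=> ts ss ut; rewrite injsum_merge // mulmxBr mulmxA scalerBl; congr (_ - _).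
  rewrite mulmx_sumr (eq_bigr (fun=> u)) // sumr_const -scaler_nat -scalemxAl.
  by congr (_%:R *: _); apply: eq_card => x; rewrite !inE.
rewrite mulmx_sumr (eq_bigr (fun=> u *m injsum s X)).
  by rewrite sumr_const card_ord scaler_nat.
move=> [j js] _ /=; rewrite (injsum_delete t X js) //= !mulmx_sumr.
apply: eq_bigr => x _; rewrite slot_mulE !mulmxA.
have /commutingP tj : commuting t (nth t s j) by rewrite (allP ts) ?mem_nth.
by rewrite -(mulmxA u _ (t x)) -tj mulmxA ut.
Qed.

End TrivialSlot.

(** * Averages over the group *)

Section UnitaryFamilies.

Variables (R : rcfType) (gT : finGroupType) (D : nat).
Local Notation C := R[i].
Local Notation opfun := {ffun gT -> 'M[C]_D}.
Implicit Types (s : seq opfun) (t a b : opfun) (X : {set gT}).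

Definition unitary_family t : Prop :=
  (forall g h, t (g * h)%g = t g *m t h) /\ (forall g, t g \is unitarymx).

(** For a unitary family this is the orthogonal projection onto the vectors fixed by [t]. *)
Definition average t : 'M[C]_D :=
  locked (#|{: gT}|%:R^-1 *: \sum_g t g).

(** On an isotypic piece of [t] this is a scalar, the value at [h] of the irreducible character
    divided by its degree. *)
Definition class_average t h : 'M[C]_D :=
  locked (#|{: gT}|%:R^-1 *: \sum_g t (g * h * g^-1)%g).

Lemma averageE t : average t = #|{: gT}|%:R^-1 *: \sum_g t g.
Proof. by rewrite /average -lock. Qed.

Lemma class_averageE t h :
  class_average t h = #|{: gT}|%:R^-1 *: \sum_g t (g * h * g^-1)%g.
Proof. by rewrite /class_average -lock. Qed.

Lemma card_neq0 : #|{: gT}|%:R != 0 :> C.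
Proof. by rewrite pnatr_eq0 -lt0n; apply/card_gt0P; exists 1%g. Qed.

Lemma family1 t : unitary_family t -> t 1%g = 1%:M.
Proof.
move=> [tM tU]; have := tM 1%g 1%g; rewrite mulg1.
move=> /(congr1 (fun A => A *m (t 1%g)^t*)).
by rewrite mulmxtVK // (unitarymxP (tU _)) => /esym.
Qed.

Lemma familyV t g : unitary_family t -> t g^-1%g = (t g)^t*.
Proof.
move=> tF; have [tM tU] := tF.
by rewrite -[LHS](mulmxtVK _ (tU g)) -tM mulVg family1 // mul1mx.
Qed.

Lemma family_slot_mul a b : unitary_family a -> unitary_family b ->
  commuting a b -> unitary_family (slot_mul a b).
Proof.
move=> [aM aU] [bM bU] /commutingP ab; split=> [g h | g]; rewrite !slot_mulE.
  by rewrite aM bM -!mulmxA; congr (_ *m _); rewrite !mulmxA ab.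
by rewrite mul_unitarymx.
Qed.

Lemma mul_average t g : unitary_family t -> t g *m average t = average t.
Proof.
move=> [tM _]; rewrite averageE -scalemxAr mulmx_sumr; congr (_ *: _).
rewrite [RHS](reindex_inj (mulgI g)) /=.
by apply: eq_bigr => h _; rewrite tM.
Qed.

Lemma average_mul t g : unitary_family t -> average t *m t g = average t.
Proof.
move=> [tM _]; rewrite averageE -scalemxAl mulmx_suml; congr (_ *: _).
rewrite [RHS](reindex_inj (mulIg g)) /=.
by apply: eq_bigr => h _; rewrite tM.
Qed.

Lemma average_idem t : unitary_family t -> average t *m average t = average t.
Proof.
move=> tF; rewrite {1}averageE -scalemxAl mulmx_suml.
under eq_bigr do rewrite mul_average //.
rewrite sumr_const -[_ *+ #|_|]scaler_nat scalerA mulVf ?scale1r //.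
exact: card_neq0.
Qed.

Lemma average_adjoint t : unitary_family t -> (average t)^t* = average t.
Proof.
move=> tF; rewrite averageE linearZ /= map_mxZ /= fmorphV /= conjC_nat.
congr (_ *: _); rewrite raddf_sum /= raddf_sum /=.
rewrite [RHS](reindex_inj invg_inj) /=.
by apply: eq_bigr => h _; rewrite familyV.
Qed.

Lemma average_fix k (u : 'M_(k, D)) t : (forall g, u *m t g = u) ->
  u *m average t = u.
Proof.
move=> h; rewrite averageE -scalemxAr mulmx_sumr (eq_bigr (fun=> u)) // sumr_const.
rewrite -[_ *+ #|_|]scaler_nat scalerA mulVf ?scale1r //.
exact: card_neq0.
Qed.

Lemma comm_average t (A : 'M_D) : (forall g, t g *m A = A *m t g) ->
  average t *m A = A *m average t.
Proof.
move=> h; rewrite averageE -scalemxAl -scalemxAr mulmx_suml mulmx_sumr; congr (_ *: _).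
by apply: eq_bigr.
Qed.

Lemma comm_class_average t x (A : 'M_D) : (forall g, t g *m A = A *m t g) ->
  class_average t x *m A = A *m class_average t x.
Proof.
move=> h; rewrite class_averageE -scalemxAl -scalemxAr mulmx_suml mulmx_sumr; congr (_ *: _).
by apply: eq_bigr.
Qed.

Lemma class_averageJ t x y :
  class_average t (y * x * y^-1)%g = class_average t x.
Proof.
rewrite !class_averageE; congr (_ *: _); rewrite [RHS](reindex_inj (mulIg y)) /=.
by apply: eq_bigr => g _; rewrite invMg !mulgA.
Qed.

Lemma comm_class_average_self t x g : unitary_family t ->
  class_average t x *m t g = t g *m class_average t x.
Proof.
move=> tF; have [tM _] := tF.
rewrite class_averageE -scalemxAl -scalemxAr mulmx_suml mulmx_sumr; congr (_ *: _).
rewrite (reindex_inj (mulgI g)) /=; apply: eq_bigr => h _.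
by rewrite -!tM invMg !mulgA mulgKV.
Qed.

Lemma class_average1 t : unitary_family t -> class_average t 1%g = 1%:M.
Proof.
move=> tF; rewrite class_averageE.
under eq_bigr do rewrite mulg1 mulgV family1 //.
rewrite sumr_const -[_ *+ #|_|]scaler_nat scalerA mulVf ?scale1r //.
exact: card_neq0.
Qed.

End UnitaryFamilies.

(** * Class averages acting as scalars *)

Section ConvolutionIdempotents.

Variables (C : numFieldType) (gT : finGroupType).

(** In a full-rank factorisation of [A], idempotence makes the product of the factors in the
    opposite order the identity of size [\rank A]; the trace is cyclic. *)
Lemma trace_idempotent (F : fieldType) n (A : 'M[F]_n) :
  A *m A = A -> \tr A = (\rank A)%:R.
Proof.
move=> AA; have e : row_base A *m col_base A = 1%:M.
  apply: (row_full_inj (col_base_full A)); apply: (row_free_inj (row_base_free A)).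
  by rewrite /= mulmx1 mulmxA -mulmxA !mulmx_base.
by rewrite -{1}(mulmx_base A) mxtrace_mulC e mxtrace1.
Qed.

(* The matrix z (x^-1 y) is n c times an idempotent and has trace n, so 1 / c is
   its rank. *)
Lemma convolution_idempotent (z : gT -> C) (c : C) :
  z 1%g = 1 ->
  (forall x, \sum_h z (x * h)%g * z h^-1%g = #|{: gT}|%:R * c * z x) ->
  [\/ c = 0, exists2 r, (1 < r)%N & c = r%:R^-1
    | c = 1 /\ {morph z : x y / (x * y)%g >-> x * y}].
Proof.
move=> z1 zz; have [-> | c0] := eqVneq c 0; first by constructor 1.
have n0 : #|{: gT}|%:R != 0 :> C.
  by rewrite pnatr_eq0 -lt0n; apply/card_gt0P; exists 1%g.
pose nc := #|{: gT}|%:R * c; have nc0 : nc != 0 by rewrite mulf_neq0.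
pose A : 'M[C]_#|{: gT}| :=
  \matrix_(i, j) (nc^-1 * z ((enum_val i)^-1 * enum_val j)%g).
have AA : A *m A = A.
  apply/matrixP => i k; rewrite !mxE.
  rewrite -[X in _ = _ * X](mulKf nc0) -zz mulrA mulr_sumr.
  under eq_bigr do rewrite !mxE.
  (* With [x = i^-1 k] and [h = k^-1 j] the entry [z (i^-1 j) z (j^-1 k)] is [z (x h) z (h^-1)]. *)
  rewrite [RHS](reindex (fun j : 'I_#|{: gT}| => (enum_val k)^-1 * enum_val j)%g) /=; last first.
    exists (fun x => enum_rank (enum_val k * x)%g) => x _.
      by rewrite mulKVg enum_valK.
    by rewrite enum_rankK mulKg.
  apply: eq_bigr => j _; rewrite invMg invgK !mulgA mulgK.
  by rewrite -!mulrA; congr (_ * _); rewrite mulrCA.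
have trA : \tr A = c^-1.
  rewrite /mxtrace; under eq_bigr do rewrite mxE mulVg z1 mulr1.
  rewrite sumr_const card_ord /nc invfM -mulrnAl -[_ *+ _]mulr_natl mulfV //.
  by rewrite mul1r.
have := trace_idempotent AA; rewrite trA => cr.
have c_rank : c = (\rank A)%:R^-1 by rewrite -cr invrK.
have [r1 | r1] := ltnP 1 (\rank A); first by constructor 2; exists (\rank A).
have {}r1 : \rank A = 1.
  apply/eqP; rewrite eqn_leq r1 lt0n; apply/eqP => r0.
  by move: c0; rewrite c_rank r0 invr0 eqxx.
constructor 3; have c1 : c = 1 by rewrite c_rank r1 invr1.
split=> // x y; move: (mulmx_base A); move: (col_base A) (row_base A).
rewrite r1 => u v uv.
have Ae i j : nc^-1 * z ((enum_val i)^-1 * enum_val j)%g = u i 0 * v 0 j.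
  by move/matrixP: uv => /(_ i j); rewrite !mxE big_ord1 => ->.
have Axy a b : nc^-1 * z (a^-1 * b)%g = u (enum_rank a) 0 * v 0 (enum_rank b).
  by rewrite -Ae !enum_rankK.
(* The matrix has rank one, so its minor on the rows [x^-1], [1] and the columns [y], [1] vanishes:
   this is [z (x y) z 1 = z x z y]. *)
apply: (mulfI (expf_neq0 2 (invr_neq0 nc0))).
transitivity ((nc^-1 * z (x^-1^-1 * y)%g) * (nc^-1 * z (1^-1 * 1)%g)).
  by rewrite invgK mulVg z1; ring.
rewrite !Axy; transitivity ((nc^-1 * z (x^-1^-1 * 1)%g) * (nc^-1 * z (1^-1 * y)%g)).
  by rewrite !Axy; ring.
by rewrite invgK mulg1 invg1 mul1g; ring.
Qed.

End ConvolutionIdempotents.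

Section ScalarClassAverages.

Variables (R : rcfType) (gT : finGroupType) (D : nat).
Local Notation C := R[i].
Local Notation opfun := {ffun gT -> 'M[C]_D}.
Local Notation n := (#|{: gT}|%:R : C).
Implicit Types (t a b : opfun) (W : 'M[C]_D) (z : gT -> C).

Definition class_scalar t W z : Prop :=
  forall h, W *m class_average t h = z h *: W.

(** For an irreducible character of degree [d], divided by [d], this is [1 / d^2]. *)
Definition mean_square z : C := n^-1 * \sum_h z h * z h^-1%g.

Lemma scale_inj (W : 'M[C]_D) (x y : C) : W != 0 -> x *: W = y *: W -> x = y.
Proof.
move=> W0 /eqP; rewrite -subr_eq0 -scalerBl scaler_eq0 (negPf W0) orbF subr_eq0.
by move/eqP.
Qed.

Lemma class_scalar1 t W z : W != 0 -> unitary_family t -> class_scalar t W z ->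
  z 1%g = 1.
Proof.
move=> W0 tF Wz; apply: (scale_inj W0).
by rewrite -Wz class_average1 // mulmx1 scale1r.
Qed.

Lemma class_scalarJ t W z : W != 0 -> class_scalar t W z ->
  forall x y, z (y * x * y^-1)%g = z x.
Proof.
by move=> W0 Wz x y; apply: (scale_inj W0); rewrite -!Wz class_averageJ.
Qed.

Lemma sum_class_average t (f : gT -> C) :
  (forall x y, f (y * x * y^-1)%g = f x) ->
  \sum_h f h *: t h = \sum_h f h *: class_average t h.
Proof.
move=> fJ; under [RHS]eq_bigr do rewrite class_averageE scalerA mulrC -scalerA scaler_sumr.
rewrite -scaler_sumr exchange_big /=.
rewrite [X in _ = _ *: X](eq_bigr (fun=> \sum_h f h *: t h)).
  rewrite sumr_const -[_ *+ #|_|]scaler_nat scalerA mulVf ?scale1r //.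
  exact: card_neq0.
move=> g _; rewrite [RHS](reindex_inj (conjg_inj g^-1%g)) /=.
by apply: eq_bigr => h _; rewrite conjgE invgK mulgA fJ.
Qed.

Lemma class_scalar_sum t W z (f : gT -> C) :
  (forall x y, f (y * x * y^-1)%g = f x) -> class_scalar t W z ->
  W *m (\sum_h f h *: t h) = (\sum_h f h * z h) *: W.
Proof.
move=> fJ Wz; rewrite (sum_class_average _ fJ) mulmx_sumr scaler_suml.
by apply: eq_bigr => h _; rewrite -scalemxAr Wz scalerA.
Qed.

Lemma class_functionV z : (forall x y, z (y * x * y^-1)%g = z x) ->
  forall x y, z (y * x * y^-1)^-1%g = z x^-1%g.
Proof. by move=> zJ x y; rewrite !invMg invgK mulgA zJ. Qed.

Lemma class_scalar_mean t W z : W != 0 -> class_scalar t W z ->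
  W *m (\sum_h z h^-1%g *: t h) = (n * mean_square z) *: W.
Proof.
move=> W0 Wz; rewrite mulVKf ?card_neq0 //.
rewrite (class_scalar_sum (f := fun h => z h^-1%g) _ Wz).
  by congr (_ *: _); apply: eq_bigr => h _; rewrite mulrC.
exact/class_functionV/(class_scalarJ W0 Wz).
Qed.

(** Compute in two ways the scalar by which [class_average t x] times [\sum_h z h^-1 *: t h] acts on
    [W]: factor by factor, or after expanding into class averages at the elements [x * h]. The
    result is the hypothesis of [convolution_idempotent]. *)
Lemma class_scalar_convolution t W z :
  W != 0 -> unitary_family t -> class_scalar t W z ->
  forall x, \sum_h z (x * h)%g * z h^-1%g = n * mean_square z * z x.
Proof.
move=> W0 tF Wz x; have [tM _] := tF; have zJ := class_scalarJ W0 Wz.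
apply: (scale_inj W0); rewrite [X in _ = X *: _]mulrC -scalerA.
rewrite -(class_scalar_mean W0 Wz) scalemxAl -Wz -mulmxA.
transitivity (W *m (\sum_h z h^-1%g *: class_average t (x * h)%g)).
  rewrite mulmx_sumr scaler_suml; apply: eq_bigr => h _.
  by rewrite -scalemxAr Wz scalerA mulrC.
congr (_ *m _); rewrite class_averageE.
under eq_bigr do rewrite class_averageE scalerA mulrC -scalerA scaler_sumr.
rewrite -scaler_sumr -scalemxAl; congr (_ *: _); rewrite exchange_big mulmx_suml.
apply: eq_bigr => g _ /=; rewrite [X in _ *m X](reindex_inj (conjg_inj g^-1%g)) /=.
rewrite mulmx_sumr; apply: eq_bigr => h _.
have -> : (h ^ g^-1 = g * h * g^-1)%g by rewrite conjgE invgK mulgA.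
rewrite class_functionV // -scalemxAr -tM; congr (_ *: t _).
by rewrite !mulgA mulgKV.
Qed.

(** The element [E = n^-1 \sum_h z h^-1 *: t h] acts as the identity on [W] because the mean square
    is 1, and multiplicativity gives [E *m t g = z g *: E]. *)
Lemma class_scalar_character t W z :
  W != 0 -> unitary_family t -> class_scalar t W z ->
  mean_square z = 1 -> {morph z : x y / (x * y)%g >-> x * y} ->
  forall g, W *m t g = z g *: W.
Proof.
move=> W0 tF Wz z1 zM g; have [tM _] := tF.
have e := class_scalar_mean W0 Wz; rewrite z1 mulr1 in e.
apply: (scalerI (card_neq0 R gT)); rewrite scalemxAl -e -mulmxA.
rewrite scalerA mulrC -scalerA -e scalemxAr; congr (_ *m _).
rewrite mulmx_suml scaler_sumr [RHS](reindex_inj (mulIg g)) /=.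
apply: eq_bigr => h _; rewrite scalerA -zM -scalemxAl tM invMg mulgA mulgV.
by rewrite mul1g.
Qed.

Lemma mul_average_slot_mul a b x : unitary_family a -> unitary_family b ->
  commuting a b ->
  a x *m average (slot_mul a b) = b x^-1%g *m average (slot_mul a b).
Proof.
move=> aF bF ab; have pF := family_slot_mul aF bF ab; have /commutingP ab' := ab.
have [bM _] := bF.
rewrite -[in RHS](mul_average x pF) slot_mulE ab' !mulmxA -bM mulVg family1 //.
by rewrite mul1mx.
Qed.

(** On the range of the projection [a g] acts as [b g^-1], so each term [a g *m b g *m b x] of the
    left factor turns into [b (g x g^-1)]. *)
Lemma average_conj a b x : unitary_family a -> unitary_family b ->
  commuting a b ->
  average (slot_mul a b) *m b x *m average (slot_mul a b)
    = class_average b x *m average (slot_mul a b).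
Proof.
move=> aF bF ab; have pF := family_slot_mul aF bF ab.
have [bM _] := bF; have /commutingP ab' := ab.
rewrite {1}averageE class_averageE -!scalemxAl; congr (_ *: _); rewrite !mulmx_suml.
apply: eq_bigr => g _; rewrite slot_mulE.
rewrite bM -[RHS]mulmxA -mul_average_slot_mul // bM.
by rewrite ab' -!mulmxA; congr (_ *m _); rewrite !mulmxA ab'.
Qed.

Lemma slot_mulC a b : commuting a b -> slot_mul a b = slot_mul b a.
Proof. by move=> /commutingP ab; apply/ffunP => g; rewrite !slot_mulE ab. Qed.

(** Between two copies of the projection, [a h] and [b h^-1] agree; [average_conj] evaluates both as
    class averages. *)
Lemma class_scalar_dual a b W y z :
  unitary_family a -> unitary_family b -> commuting a b ->
  class_scalar a W y -> class_scalar b W z ->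
  W *m average (slot_mul a b) != 0 -> forall h, y h = z h^-1%g.
Proof.
move=> aF bF ab Wy Wz; set P := average _ => WP h; apply: (scale_inj WP).
have ba : commuting b a by rewrite commuting_sym.
have e1 := average_conj h bF aF ba.
have e2 := average_conj h^-1%g aF bF ab.
have e3 := mul_average_slot_mul h aF bF ab.
rewrite (slot_mulC ba) -/P in e1; rewrite -/P in e2 e3.
have -> : y h *: (W *m P) = W *m (class_average a h *m P).
  by rewrite mulmxA Wy scalemxAl.
have -> : z h^-1%g *: (W *m P) = W *m (class_average b h^-1%g *m P).
  by rewrite mulmxA Wz scalemxAl.
congr (_ *m _); apply: etrans (esym e1) _; apply: etrans e2.
by rewrite -!mulmxA; congr (_ *m _).
Qed.

(** Expand the middle projection into terms [a' h *m b h]. Since [a'] commutes with the outer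
    projection, [average_conj] replaces [b h] by [z h], and the class function [z] then makes the
    sum of [z h *: a' h] a scalar on [W]. *)
Lemma average_average a b a' W y z :
  unitary_family a -> unitary_family b -> commuting a b ->
  commuting a' a -> commuting a' b ->
  (forall x y, z (y * x * y^-1)%g = z x) ->
  class_scalar a' W y -> class_scalar b W z ->
  W *m average (slot_mul a b) *m average (slot_mul a' b)
      *m average (slot_mul a b)
    = (#|{: gT}|%:R^-1 * \sum_h z h * y h) *: (W *m average (slot_mul a b)).
Proof.
move=> aF bF ab /commutingP aa /commutingP a'b zJ Wy Wz.
set P := average (slot_mul a b).
have a'P h : a' h *m P = P *m a' h.
  by apply/esym/comm_average => g; rewrite slot_mulE -mulmxA -a'b !mulmxA aa.
rewrite -scalerA scalemxAl -(class_scalar_sum zJ Wy) (averageE (slot_mul a' b)).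
rewrite -scalemxAr -scalemxAl; congr (_ *: _).
rewrite !mulmx_sumr !mulmx_suml; apply: eq_bigr => h _; rewrite slot_mulE.
have e := average_conj h aF bF ab; rewrite -/P in e.
have WP : z h *: (W *m P) = W *m (P *m b h *m P).
  by rewrite e mulmxA Wz scalemxAl.
transitivity (W *m (P *m b h *m P) *m a' h).
  by rewrite a'b -!mulmxA a'P.
by rewrite -WP -scalemxAl -scalemxAr -scalemxAl -!mulmxA a'P.
Qed.

End ScalarClassAverages.

(** * Sums of projections with small pairwise overlap *)

Section ProjectionSums.

Variables (R : rcfType) (D : nat).
Local Notation C := R[i].

(** Let [S] be the sum of the [w P_i] and [A] that of their squared norms, so [<S, w> = A]. The
    overlaps give [|S|^2 <= kappa A], and the inequality of means with weight [1 / kappa] gives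
    [2 A <= A + kappa |w|^2]. *)
Lemma sum_sqnorm_projections (I : finType) (P : I -> 'M[C]_D) (w : 'rV[C]_D)
    (s kappa : R) :
  (forall i, (P i)^t* = P i) -> (forall i, P i *m P i = P i) ->
  (forall i j, i != j -> rdot (w *m P i) (w *m P j)
     <= s / 2 * (sqnorm (w *m P i) + sqnorm (w *m P j))) ->
  0 < kappa -> 1 + (#|I|%:R - 1) * s <= kappa ->
  \sum_i sqnorm (w *m P i) <= kappa * sqnorm w.
Proof.
move=> hP iP hs k0 hk; set A := \sum_i _.
have A0 : 0 <= A by apply: sumr_ge0 => i _; apply: sqnorm_ge0.
pose S := \sum_i w *m P i.
have SA : rdot S w = A.
  by rewrite rdot_suml; apply: eq_bigr => i _; rewrite (rdot_herm_proj _ _ (hP i)).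
have row_le i : rdot (w *m P i) S
    <= sqnorm (w *m P i) + s / 2 * (#|I|%:R * sqnorm (w *m P i) + A
       - 2 * sqnorm (w *m P i)).
  rewrite rdot_sumr (bigD1 i) //=.
  have -> : #|I|%:R * sqnorm (w *m P i) + A - 2 * sqnorm (w *m P i)
      = \sum_(j | j != i) (sqnorm (w *m P i) + sqnorm (w *m P j)).
    apply: (addrI (sqnorm (w *m P i) + sqnorm (w *m P i))).
    transitivity (\sum_j (sqnorm (w *m P i) + sqnorm (w *m P j))); last by rewrite (bigD1 i).
    rewrite big_split /= sumr_const -/A -[_ *+ #|_|]mulr_natl; ring.
  rewrite lerD // mulr_sumr ler_sum // => j ji.
  by apply: hs; rewrite eq_sym.
have NS : sqnorm S <= kappa * A.
  rewrite /sqnorm {1}/S rdot_suml; apply: (le_trans (ler_sum _ (fun i _ => row_le i))).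
  rewrite big_split /= -mulr_sumr sumrB big_split /= -!mulr_sumr sumr_const -/A.
  rewrite -[_ *+ #|_|]mulr_natl.
  apply: (le_trans _ (ler_wpM2r A0 hk)); rewrite le_eqVlt; apply/orP; left.
  by apply/eqP; field.
have := rdot_le S w (t := kappa^-1); rewrite invr_gt0 invrK SA => /(_ k0) h.
have : kappa^-1 * sqnorm S <= A by rewrite ler_pdivrMl.
lra.
Qed.

End ProjectionSums.

(** * The inductive bound *)

Section Induction.

Variables (R : rcfType) (gT : finGroupType) (D : nat).
Local Notation C := R[i].
Local Notation opfun := {ffun gT -> 'M[C]_D}.
Local Notation n := #|{: gT}|.
Implicit Types (s : seq opfun) (t a b : opfun) (W : 'M[C]_D) (w : 'rV[C]_D).

Definition invariant_free s W : Prop :=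
  [/\ {in s, forall t, unitary_family t}, pairwise (@commuting C gT D) s,
      {in s, forall t g, (W *m t g <= W)%MS}
    & {in s, forall t, W *m average t = 0}].

Definition occurs (chi : gT -> C) t W : Prop :=
  exists u : 'rV[C]_D, [/\ (u <= W)%MS, u != 0 & forall g, u *m t g = chi g *: u].

Definition order_two_character (chi : gT -> C) : Prop :=
  [/\ {morph chi : x y / (x * y)%g >-> x * y}, forall g, chi g ^+ 2 = 1
    & exists g, chi g != 1].

Definition multiplicity chi s W := count (fun t => `[< occurs chi t W >]) s.

(* Merging two slots lowers the admissible K by at most two. *)
Definition order_two_deficit (K : nat) s W : Prop :=
  (K <= size s)%N /\ forall chi, order_two_character chi ->
    (K + multiplicity chi s W <= size s)%N.

(** The last two factors are the square of the falling factorial divided by the binomial coefficient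
    of [n] and [m]. *)
Definition sq_bound (m K : nat) : R :=
  (99 / 100) ^+ (2 * K) * (n ^_ m)%:R * m`!%:R.

Definition injsum_bounded m : Prop := forall K s W,
  size s = m -> invariant_free s W -> order_two_deficit K s W ->
  forall w, (w <= W)%MS ->
    sqnorm (w *m injsum s (finset.set0 : {set gT})) <= sq_bound m K * sqnorm w.

Lemma invariant_free_sub s W W' : (W' <= W)%MS ->
  {in s, forall t g, (W' *m t g <= W')%MS} ->
  invariant_free s W -> invariant_free s W'.
Proof.
move=> sub st [h1 h2 h3 h4]; split=> // t ts.
by have /submxP[B ->] := sub; rewrite -mulmxA h4 // mulmx0.
Qed.

Lemma occurs_sub chi t W W' : (W' <= W)%MS -> occurs chi t W' -> occurs chi t W.
Proof. by move=> sub [u [uW u0 ut]]; exists u; split=> //; apply: submx_trans sub. Qed.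

Lemma multiplicity_sub chi s W W' : (W' <= W)%MS ->
  (multiplicity chi s W' <= multiplicity chi s W)%N.
Proof.
move=> sub; apply: sub_count => t /= /asboolP h.
by apply/asboolP/(occurs_sub sub h).
Qed.

Lemma order_two_deficit_sub K s W W' : (W' <= W)%MS ->
  order_two_deficit K s W -> order_two_deficit K s W'.
Proof.
move=> sub [Ks h]; split=> // chi chi2; apply: leq_trans (h chi chi2).
by rewrite leq_add2l multiplicity_sub.
Qed.

Lemma invariant_free_perm s s' W : perm_eq s s' ->
  invariant_free s W -> invariant_free s' W.
Proof.
move=> e [h1 h2 h3 h4]; rewrite (perm_pairwise_commuting e) in h2.
by split=> // t; rewrite -(perm_mem e); [apply: h1 | apply: h3 | apply: h4].
Qed.

Lemma order_two_deficit_perm K s s' W : perm_eq s s' ->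
  order_two_deficit K s W -> order_two_deficit K s' W.
Proof.
move=> e [Ks h]; rewrite /order_two_deficit /multiplicity -(perm_size e).
by split=> // chi chi2; rewrite -(seq.permP e); apply: h.
Qed.

(** The common factor [c] of the three bounds cancels from the inductive step. As [K - 2] is
    truncated, the exponent [2 * K - 2 * K'] is 0, 2 or 4. *)
Lemma falling_bounds (p K : nat) : (3 * p.+2 <= n)%N ->
  let K' := (K - 2)%N in let N := (n - p)%:R : R in
  let c := (99 / 100) ^+ (2 * K') * (n ^_ p)%:R * p`!%:R * N in
  [/\ 0 <= c, N ^+ 2 * sq_bound p K' = c * N, sq_bound p.+1 K' = c * p.+1%:R
    & sq_bound p.+2 K = c * ((99 / 100) ^+ (2 * K - 2 * K') * (N - 1)
        * (p.+1%:R * p.+2%:R))].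
Proof.
move=> hn K' N c; rewrite /c /sq_bound; split.
- by rewrite !mulr_ge0 ?exprn_ge0 ?ler0n //; lra.
- by ring.
- by rewrite ffactnSr factS !natrM -/N; ring.
have -> : (2 * K = 2 * K' + (2 * K - 2 * K'))%N by lia.
have -> : N - 1 = (n - p.+1)%:R by rewrite /N -(natrB _ (_ : 1 <= n - p)%N) ?subn1 ?subnS //; lia.
rewrite addKn exprD !ffactnSr !factS !natrM -/N; ring.
Qed.

(* [kappa] measures the overlap of the projections on the invariants of the
   merged slots: there the merged slot disappears, elsewhere it survives. *)
Lemma injsum_step K p t s W w (kappa : R) :
  size s = p.+1 -> (3 * p.+2 <= n)%N ->
  injsum_bounded p -> injsum_bounded p.+1 ->
  invariant_free (t :: s) W -> order_two_deficit K (t :: s) W -> (w <= W)%MS ->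
  \sum_(j < size s) sqnorm (w *m average (slot_mul (nth t s j) t))
    <= kappa * sqnorm w ->
  p.+1%:R ^+ 2 + ((n - p)%:R - p.+1%:R) * kappa
    <= (99 / 100) ^+ (2 * K - 2 * (K - 2)) * ((n - p)%:R - 1) * p.+2%:R :> R ->
  sqnorm (w *m injsum (t :: s) (finset.set0 : {set gT}))
    <= sq_bound p.+2 K * sqnorm w.
Proof.
move=> ss hn IHp IHp1 good def wW hkappa hnum.
have [c0 ea eb ec] := falling_bounds K hn.
move: c0 ea eb ec; set K' := (K - 2)%N; set N := (n - p)%:R; set c := (_ * N).
move=> c0 ea eb ec.
have [fam pw stab av0] := good; have [Ks chi_le] := def.
move: pw; rewrite pairwise_cons => /andP[ts pw].
have tF : unitary_family t by apply: fam; rewrite mem_head.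
have sF j : (j < size s)%N -> unitary_family (nth t s j).
  by move=> js; apply: fam; rewrite in_cons mem_nth ?orbT.
have st j : (j < size s)%N -> commuting (nth t s j) t.
  by move=> js; rewrite commuting_sym (allP ts) // mem_nth.
have del_sub j : {subset delete s j <= s}.
  by move=> a; rewrite mem_cat => /orP[/mem_take | /mem_drop].
(* The unrestricted sum of [t] is a multiple of its average, which vanishes on [W]; only merged
   terms remain. *)
have T0 : w *m injsum (t :: s) (finset.set0 : {set gT}) = - \sum_(j < size s)
    w *m injsum (slot_mul (nth t s j) t :: delete s j) finset.set0.
  rewrite injsum_merge // mulmxBr mulmxA -mulmx_sumr.
  have -> : \sum_(x | x \notin (finset.set0 : {set gT})) t x = n%:R *: average t.
    rewrite averageE scalerA mulfV ?card_neq0 // scale1r.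
    by apply: eq_bigl => x; rewrite finset.in_set0.
  rewrite -scalemxAr; have /submxP[B ->] := wW.
  by rewrite -[B *m W *m average t]mulmxA av0 ?mem_head // mulmx0 scaler0 mul0mx sub0r.
rewrite T0 sqnormN; apply: (le_trans (sqnorm_sum _)); rewrite card_ord.
have slot j : (j < size s)%N ->
  sqnorm (w *m injsum (slot_mul (nth t s j) t :: delete s j)
      (finset.set0 : {set gT}))
    <= c * N * sqnorm (w *m average (slot_mul (nth t s j) t))
       + c * p.+1%:R
         * (sqnorm w - sqnorm (w *m average (slot_mul (nth t s j) t))).
  move=> js; set a := nth t s j; set d := delete s j; set P := average _.
  have aF : unitary_family (slot_mul a t).
    exact: family_slot_mul (sF j js) tF (st j js).
  have hP : P^t* = P by apply: average_adjoint.
  have iP : P *m P = P by apply: average_idem.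
  have pe : perm_eq s (a :: d) by apply: perm_delete.
  have pwd : pairwise (@commuting C gT D) (a :: d).
    by rewrite -(perm_pairwise_commuting pe).
  move: pwd; rewrite pairwise_cons => /andP[ad pwd].
  have td : all (commuting t) d.
    by apply/allP => b bd; rewrite (allP ts) // (del_sub j).
  have atd : all (commuting (slot_mul a t)) d.
    by apply/allP => b bd; apply: commuting_slot_mul; [apply: (allP ad) | apply: (allP td)].
  have sd : size d = p by rewrite size_delete // ss.
  have comP b : b \in d -> forall g, b g *m P = P *m b g.
    move=> bd g; apply/esym/comm_average => h.
    by have /commutingP -> := allP atd b bd.
  have comPT : injsum (slot_mul a t :: d) (finset.set0 : {set gT}) *m P
      = P *m injsum (slot_mul a t :: d) finset.set0.
    apply: comm_injsum => b; rewrite in_cons => /orP[/eqP -> | /comP] // g.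
    by rewrite mul_average // average_mul.
  rewrite (sqnorm_herm_proj _ hP iP) -[_ *m P]mulmxA comPT mulmxA -mulmxBl.
  have PW : (W *m P <= W)%MS.
    rewrite /P averageE -scalemxAr mulmx_sumr scalemx_sub // summx_sub // => g _.
    rewrite slot_mulE mulmxA; apply: (submx_trans (submxMr _ (stab a _ g))).
      by rewrite in_cons mem_nth ?orbT.
    by apply: stab; rewrite mem_head.
  have wPW : (w *m P <= W)%MS by apply: submx_trans PW; apply: submxMr.
  apply: lerD.
    (* On the range of [P] the merged slot is trivial and contributes the factor [N], with [p] slots
       left. *)
    rewrite injsum_trivial // => [|g]; last by rewrite -mulmxA average_mul.
    have -> : (#|~: (finset.set0 : {set gT})|%:R - (size d)%:R : C) = N%:C%C.
      rewrite finset.setC0 finset.cardsT sd /N natrB ?rmorphB ?rmorph_nat //.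
      by move: hn; clear; lia.
    rewrite sqnormZ -ea -mulrA ler_wpM2l ?sqr_ge0 //.
    apply: (IHp K' d W) => //.
      have ds b : b \in d -> b \in t :: s.
        by move=> bd; rewrite in_cons (del_sub j) ?orbT.
      split; [by move=> b /ds/fam | exact: pwd | | by move=> b /ds/av0].
      by move=> b /ds bs g; apply: stab.
    (* Two slots are gone while the multiplicity of [chi] may stay the same, hence the loss of two
       in [K]. *)
    split; first by rewrite sd; move: Ks; rewrite /= ss /K'; clear; lia.
    move=> chi chi2; have := chi_le chi chi2.
    have := seq.permP pe (fun t => `[< occurs chi t W >]).
    have := count_size (fun t => `[< occurs chi t W >]) d.
    by rewrite /multiplicity /= ss sd /K'; clear; lia.
  have -> : sqnorm w - sqnorm (w *m P) = sqnorm (w - w *m P).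
    by rewrite (sqnorm_herm_proj w hP iP); ring.
  (* [W0] is the part of [W] without invariants of the merged slot, so the hypothesis for [p.+1]
     slots applies there. *)
  rewrite -eb; pose W0 := (W :&: kermx P)%MS.
  have W0P : W0 *m P = 0 by apply/sub_kermxP; rewrite capmxSr.
  have W0W : (W0 <= W)%MS by rewrite capmxSl.
  have stab0 b : (forall g, b g *m P = P *m b g) ->
      (forall g, (W *m b g <= W)%MS) -> forall g, (W0 *m b g <= W0)%MS.
    move=> bP bW g; rewrite sub_capmx (submx_trans (submxMr _ W0W)) //=.
    by apply/sub_kermxP; rewrite -mulmxA bP mulmxA W0P mul0mx.
  apply: (IHp1 K' (slot_mul a t :: d) W0) => //.
  - by rewrite /= sd.
  - split.
    + move=> b; rewrite in_cons => /orP[/eqP -> // | bd].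
      by apply: fam; rewrite in_cons (del_sub j) ?orbT.
    + by rewrite pairwise_cons atd.
    + move=> b; rewrite in_cons => /orP[/eqP -> | bd] g; apply: stab0 => // h.
      * by rewrite mul_average // average_mul.
      * rewrite slot_mulE mulmxA; apply: (submx_trans (submxMr _ (stab a _ h))).
          by rewrite in_cons mem_nth ?orbT.
        by apply: stab; rewrite mem_head.
      * exact: comP.
      * by apply: stab; rewrite in_cons (del_sub j) ?orbT.
    + move=> b; rewrite in_cons => /orP[/eqP -> // | bd].
      have /submxP[B ->] := W0W.
      by rewrite -mulmxA av0 ?mulmx0 // in_cons (del_sub j) ?orbT.
  (* Only one slot is lost, but the merged slot may itself carry [chi]: again a loss of two. *)
  - split; first by move: Ks; rewrite /= ss sd /K'; clear; lia.
    move=> chi chi2; have := chi_le chi chi2.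
    have := seq.permP pe (fun t => `[< occurs chi t W >]).
    have := count_size (fun t => `[< occurs chi t W >]) d.
    have := multiplicity_sub chi d W0W.
    rewrite /multiplicity /= ss sd /K'.
    by case: (asbool (occurs chi _ W0)); clear; lia.
  - rewrite sub_capmx addmx_sub ?eqmx_opp //=.
    by apply/sub_kermxP; rewrite mulmxBl -mulmxA iP subrr.
have sum_le : \sum_(j < size s)
    sqnorm (w *m injsum (slot_mul (nth t s j) t :: delete s j)
      (finset.set0 : {set gT}))
  <= \sum_(j < size s)
    (c * N * sqnorm (w *m average (slot_mul (nth t s j) t))
       + c * p.+1%:R
         * (sqnorm w - sqnorm (w *m average (slot_mul (nth t s j) t)))).
  by apply: ler_sum => j _; apply: slot.
apply: (le_trans (ler_wpM2l (ler0n _ _) sum_le)).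
rewrite big_split /= -!mulr_sumr sumrB sumr_const card_ord ss -[sqnorm w *+ _]mulr_natl.
move: hkappa; rewrite ss; set A := \sum_(j < _) _ => hkappa.
have Nw := sqnorm_ge0 w.
have Np : p.+1%:R <= N by rewrite /N ler_nat; move: hn; clear; lia.
(* Since [p.+1 <= N], the left side increases with [A], which [kappa] bounds. *)
have h1 : c * N * A + c * p.+1%:R * (p.+1%:R * sqnorm w - A)
    <= c * (p.+1%:R ^+ 2 + (N - p.+1%:R) * kappa) * sqnorm w.
  rewrite -subr_ge0.
  have -> : c * (p.+1%:R ^+ 2 + (N - p.+1%:R) * kappa) * sqnorm w -
     (c * N * A + c * p.+1%:R * (p.+1%:R * sqnorm w - A))
     = c * ((N - p.+1%:R) * (kappa * sqnorm w - A)) by ring.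
  by rewrite mulr_ge0 // mulr_ge0 ?subr_ge0.
apply: (le_trans (ler_wpM2l (ler0n _ _) h1)); rewrite mulrA ler_wpM2r // ec.
rewrite mulrCA ler_wpM2l //.
have -> : (99 / 100) ^+ (2 * K - 2 * K') * (N - 1) * (p.+1%:R * p.+2%:R)
  = p.+1%:R * ((99 / 100) ^+ (2 * K - 2 * K') * (N - 1) * p.+2%:R) :> R by ring.
by rewrite ler_wpM2l.
Qed.

End Induction.

(** * Orthogonal splitting into scalar pieces *)

Section MainInduction.

Variables (R : rcfType) (gT : finGroupType) (D : nat).
Local Notation C := R[i].
Local Notation opfun := {ffun gT -> 'M[C]_D}.
Local Notation n := #|{: gT}|.
Implicit Types (s : seq opfun) (t a b : opfun) (W : 'M[C]_D) (w : 'rV[C]_D).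

Lemma sqnorm_eq0 (u : 'rV[C]_D) : sqnorm u = 0 -> u = 0.
Proof.
rewrite /sqnorm rdotE => h; apply/rowP => j; rewrite mxE.
have sq0 i : 0 <= complex.Re (u 0 i) * complex.Re (u 0 i)
    + complex.Im (u 0 i) * complex.Im (u 0 i).
  by rewrite -!expr2 addr_ge0 ?sqr_ge0.
have /(_ j isT) := psumr_eq0P (fun i _ => sq0 i) h.
move/eqP; rewrite -!expr2 paddr_eq0 ?sqr_ge0 // !sqrf_eq0 => /andP[/eqP r0 /eqP i0].
by apply/eqP; rewrite eq_complex r0 i0 /= eqxx.
Qed.

Lemma rdot_ortho (u v : 'rV[C]_D) W : (u <= W)%MS -> v *m W^t* = 0 -> rdot u v = 0.
Proof.
move=> /submxP[B ->] vW; rewrite rdotC /rdot trmx_mul map_mxM mulmxA vW mul0mx.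
by rewrite mxE.
Qed.

Lemma injsum_stable s W (X : {set gT}) :
  {in s, forall t g, (W *m t g <= W)%MS} -> (W *m injsum s X <= W)%MS.
Proof.
elim: s X => [|t s IH] X h /=; first by rewrite mulmx1.
rewrite mulmx_sumr summx_sub // => x _; rewrite mulmxA.
apply: (submx_trans (submxMr _ (h t _ x))); first by rewrite mem_head.
by apply: IH => a as_; apply: h; rewrite in_cons as_ orbT.
Qed.

Lemma comm_class_average_mem s t a h :
  {in s, forall t, unitary_family t} -> pairwise (@commuting C gT D) s ->
  t \in s -> a \in s ->
  forall g, a g *m class_average t h = class_average t h *m a g.
Proof.
move=> fam pw ts as_ g; have pe := perm_to_rem ts.
move: pw; rewrite (perm_pairwise_commuting pe) pairwise_cons => /andP[tr _].
move: as_; rewrite (perm_mem pe) in_cons => /orP[/eqP -> | ar].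
  by rewrite comm_class_average_self //; apply: fam.
apply/esym/comm_class_average => x.
by have /commutingP -> := allP tr a ar.
Qed.

Lemma stable_eigenvector W (Z : 'M[C]_D) : W != 0 -> (W *m Z <= W)%MS ->
  exists c, exists v : 'rV[C]_D, [/\ (v <= W)%MS, v != 0 & v *m Z = c *: v].
Proof.
move=> W0 WZ; pose B := row_base W.
have BZ : (B *m Z <= B)%MS.
  by rewrite eq_row_base; apply: submx_trans WZ; rewrite submxMr ?eq_row_base.
pose M := B *m Z *m pinvmx B.
have BM : M *m B = B *m Z by apply: mulmxKpV.
have [|c /eigenvalueP[v vM v0]] := eigenvalue_closed M.
  by rewrite lt0n mxrank_eq0.
exists c, (v *m B); split.
- by rewrite (submx_trans (submxMl _ _)) ?eq_row_base.
- by rewrite mulmx_free_eq0 ?row_base_free.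
- by rewrite -mulmxA -BM mulmxA vM scalemxAl.
Qed.

Lemma ortho_split W w : exists w1 w2 : 'rV[C]_D,
  [/\ w = w1 + w2, (w1 <= W)%MS & w2 *m W^t* = 0].
Proof.
exists (w *m proj_ortho W), (w - w *m proj_ortho W); split.
- by rewrite addrC subrK.
- exact: proj_ortho_sub.
- by apply/eqP; rewrite -orthomx1E; apply: proj_ortho_compl_sub.
Qed.

Definition scalar_on s W : Prop :=
  {in s, forall t h, exists z, W *m class_average t h = z *: W}.

(* Class averages are normal operators commuting with the whole family, so W
   splits orthogonally into invariant pieces on which they act as scalars. *)
Lemma scalar_reduction s (X : {set gT}) (B : R) W :
  invariant_free s W ->
  (forall W', (W' <= W)%MS -> W' != 0 -> invariant_free s W' ->
     scalar_on s W' -> forall w, (w <= W')%MS ->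
     sqnorm (w *m injsum s X) <= B * sqnorm w) ->
  forall w, (w <= W)%MS -> sqnorm (w *m injsum s X) <= B * sqnorm w.
Proof.
have [r] := ubnP (\rank W); elim: r W => // r IH W rW good hB w wW.
have [W0 | W0] := eqVneq W 0.
  by move: wW; rewrite W0 submx0 => /eqP ->; rewrite mul0mx sqnorm0 mulr0.
have [sc | nsc] := pselect (scalar_on s W); first exact: (hB W).
have [fam pw stab av0] := good.
have [t [ts [h nz]]] : exists t, t \in s /\ exists h,
    ~ exists z, W *m class_average t h = z *: W.
  apply: contrapT => no; apply: nsc => t ts h; apply: contrapT => nz.
  by apply: no; exists t; split=> //; exists h.
set Z := class_average t h in nz.
have comZ a : a \in s -> forall g, a g *m Z = Z *m a g.
  by move=> as_; apply: comm_class_average_mem as_.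
have WZ : (W *m Z <= W)%MS.
  rewrite /Z class_averageE -scalemxAr mulmx_sumr scalemx_sub // summx_sub // => g _.
  exact: stab.
have [c [v [vW v0 vZ]]] := stable_eigenvector W0 WZ.
pose W1 := (W :&: kermx (Z - c%:M))%MS.
have W1Z : W1 *m Z = c *: W1.
  have : W1 *m (Z - c%:M) = 0 by apply/sub_kermxP; rewrite capmxSr.
  by rewrite mulmxBr mul_mx_scalar => /eqP; rewrite subr_eq0 => /eqP.
have vW1 : (v <= W1)%MS.
  rewrite sub_capmx vW /=; apply/sub_kermxP.
  by rewrite mulmxBr mul_mx_scalar vZ subrr.
pose W2 := (W :&: kermx (W1^t*))%MS.
have W2o : W2 *m W1^t* = 0 by apply/sub_kermxP; rewrite capmxSr.
have sub1 : (W1 <= W)%MS by rewrite capmxSl.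
have sub2 : (W2 <= W)%MS by rewrite capmxSl.
have st1 : {in s, forall a g, (W1 *m a g <= W1)%MS}.
  move=> a as_ g; rewrite sub_capmx (submx_trans (submxMr _ sub1)) ?stab //=.
  apply/sub_kermxP; rewrite mulmxBr mul_mx_scalar -mulmxA comZ // mulmxA W1Z.
  by rewrite scalemxAl subrr.
(* Unitarity enters here: the adjoint of [a g] is [a g^-1], which preserves [W1]. *)
have st2 : {in s, forall a g, (W2 *m a g <= W2)%MS}.
  move=> a as_ g; rewrite sub_capmx (submx_trans (submxMr _ sub2)) ?stab //=.
  apply/sub_kermxP; have /submxP[E e] := st1 a as_ g^-1%g.
  have : (W1 *m (a g)^t*)^t* = (E *m W1)^t* by rewrite -e familyV //; apply: fam.
  rewrite !trmx_mul !map_mxM trmxCK.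
  by rewrite -mulmxA => ->; rewrite mulmxA W2o mul0mx.
(* Both ranks drop: [W1] is proper because [Z] is not scalar on [W], and [W2] because it misses
   [v]. *)
have rk1 : (\rank W1 < \rank W)%N.
  rewrite ltn_neqAle mxrankS // andbT; apply/eqP => e; apply: nz; exists c.
  have /submxP[E ->] : (W <= W1)%MS.
    by have := mxrank_leqif_sup sub1; rewrite /leqif e eqxx => -[_ <-].
  by rewrite -mulmxA W1Z scalemxAr.
have rk2 : (\rank W2 < \rank W)%N.
  rewrite ltn_neqAle mxrankS // andbT; apply/eqP => e.
  have WW2 : (W <= W2)%MS.
    by have := mxrank_leqif_sup sub2; rewrite /leqif e eqxx => -[_ <-].
  move/eqP: v0; apply; apply: sqnorm_eq0; apply: (rdot_ortho vW1).
  have /submxP[E ->] := submx_trans vW WW2.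
  by rewrite -mulmxA W2o mulmx0.
have ort u : (u <= W2)%MS -> u *m W1^t* = 0.
  by move=> /submxP[E ->]; rewrite -mulmxA W2o mulmx0.
have [w1 [w2 [e w1W w2o]]] := ortho_split W1 w.
have w2W : (w2 <= W2)%MS.
  have -> : w2 = w - w1 by rewrite e addrAC subrr add0r.
  rewrite sub_capmx addmx_sub ?eqmx_opp ?(submx_trans w1W) //=.
  by apply/sub_kermxP; rewrite e addrAC subrr add0r.
have o12 : rdot w1 w2 = 0 by apply: (rdot_ortho w1W); apply: ort.
have oT : rdot (w1 *m injsum s X) (w2 *m injsum s X) = 0.
  apply: (rdot_ortho (W := W1)).
    exact: submx_trans (submxMr _ w1W) (injsum_stable X st1).
  exact/ort/(submx_trans (submxMr _ w2W) (injsum_stable X st2)).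
have b1 : sqnorm (w1 *m injsum s X) <= B * sqnorm w1.
  apply: (IH W1 (leq_trans rk1 rW) _ _ w1 w1W).
    exact: invariant_free_sub sub1 st1 good.
  by move=> W' sub'; apply: hB; apply: submx_trans sub' sub1.
have b2 : sqnorm (w2 *m injsum s X) <= B * sqnorm w2.
  apply: (IH W2 (leq_trans rk2 rW) _ _ w2 w2W).
    exact: invariant_free_sub sub2 st2 good.
  by move=> W' sub'; apply: hB; apply: submx_trans sub' sub2.
by rewrite e mulmxDl !sqnormD o12 oT mulr0 !addr0 mulrDr lerD.
Qed.

End MainInduction.

(** * The inductive step on a scalar piece *)

Section ScalarCase.

Variables (R : rcfType) (gT : finGroupType) (D : nat).
Local Notation C := R[i].
Local Notation opfun := {ffun gT -> 'M[C]_D}.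
Local Notation n := #|{: gT}|.
Implicit Types (s : seq opfun) (t a b : opfun) (W : 'M[C]_D) (w : 'rV[C]_D).

(** The numerical condition of [injsum_step], with [x] for [p] and [N] for [n - p], when [kappa] is
    the number of projections. The left side equals [N * (x + 1)], so the claim amounts to
    [x + 2 <= N]. *)
Lemma overlap_trivial (x N : R) : 0 <= x -> 2 * x + 6 <= N ->
  (x + 1) ^+ 2 + (N - (x + 1)) * (x + 1) <= (N - 1) * (x + 2).
Proof. by move=> x0 hN; nra. Qed.

(** Halving [kappa] leaves room for [(99 / 100) ^+ 4], the price of lowering [K] by two. *)
Lemma overlap_half (x N k : R) : 0 <= x -> 2 * x + 6 <= N -> k <= (x + 2) / 2 ->
  (x + 1) ^+ 2 + (N - (x + 1)) * k <= (99 / 100) ^+ 4 * (N - 1) * (x + 2).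
Proof.
move=> x0 hN hk.
have h1 : (N - (x + 1)) * k <= (N - (x + 1)) * ((x + 2) / 2).
  by rewrite ler_wpM2l //; lra.
have h2 : 0 <= (N - (2 * x + 6)) * x by rewrite mulr_ge0 //; lra.
nra.
Qed.

(** [5 / 7] is a rational upper bound for [1 / sqrt 2], the overlap of two projections when
    [c = 1 / 2]. *)
Lemma overlap_scalar (x N k : R) : 0 <= x -> 2 * x + 6 <= N -> k <= 1 + x * (5 / 7) ->
  (x + 1) ^+ 2 + (N - (x + 1)) * k <= (99 / 100) ^+ 4 * (N - 1) * (x + 2).
Proof.
move=> x0 hN hk.
have h1 : (N - (x + 1)) * k <= (N - (x + 1)) * (1 + x * (5 / 7)).
  by rewrite ler_wpM2l //; lra.
have h2 : 0 <= (N - (2 * x + 6)) * x by rewrite mulr_ge0 //; lra.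
nra.
Qed.

(** The exponent is 2 for [K = 1] and 4 afterwards; the base is below 1, so 4 is the demanding
    case. *)
Lemma deficit_exponent (K : nat) (y z : R) : (0 < K)%N -> 0 <= y ->
  z <= (99 / 100) ^+ 4 * y -> z <= (99 / 100) ^+ (2 * K - 2 * (K - 2)) * y.
Proof.
move=> K0 y0 hz; apply: (le_trans hz); rewrite ler_wpM2r //.
by apply: ler_wiXn2l; [lra | lra | lia].
Qed.

(** The weight [7 / 5] approximates [sqrt 2]: the first coefficient is at most [7 / 10], which is
    below [5 / 7]. *)
Lemma overlap_le (c x y r u : R) : 0 <= c <= 2^-1 -> 0 <= x -> u = c * x ->
  2 * r <= 7 / 5 * u + (7 / 5)^-1 * y -> 0 <= y ->
  r <= 5 / 7 / 2 * (x + y).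
Proof.
move=> /andP[c0 c2] x0 ->; have -> : (7 / 5)^-1 = 5 / 7 :> R by field.
have h : c * x <= 2^-1 * x by rewrite ler_wpM2r.
lra.
Qed.

Lemma scalar_choice s W : scalar_on s W ->
  exists z : opfun -> gT -> C, {in s, forall t, class_scalar t W (z t)}.
Proof.
move=> sc; have h t : exists zt : gT -> C, t \in s -> class_scalar t W zt.
  have [ts | ts] := boolP (t \in s); last by exists (fun=> 0).
  have [f hf] := choice (sc t ts); exists f => _; exact: hf.
by have [z hz] := choice h; exists z => t; apply: hz.
Qed.

(** Unless [c = 0], [1 / c] is a positive integer, so [c] is 1 or at most [1 / 2]. *)
Lemma scalar_dichotomy t W z : W != 0 -> unitary_family t -> class_scalar t W z ->
  (exists2 c : R, mean_square z = c%:C%C & 0 <= c <= 2^-1)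
  \/ {morph z : x y / (x * y)%g >-> x * y} /\ forall g, W *m t g = z g *: W.
Proof.
move=> W0 tF Wz.
have := convolution_idempotent (class_scalar1 W0 tF Wz)
  (class_scalar_convolution W0 tF Wz).
case=> [-> | [r r1 ->] | [z1 zM]].
- by left; exists 0; rewrite // lexx invr_ge0 ler0n.
- left; exists r%:R^-1; first by rewrite fmorphV rmorph_nat.
  rewrite invr_ge0 ler0n lef_pV2 ?posrE ?ltr0n //; last by lia.
  by rewrite ler_nat.
by right; split=> //; apply: class_scalar_character.
Qed.

(** Here [|w P Q|^2 = c |w P|^2] and [<w P, w Q> = <w P Q, w Q>], to which the weighted inequality
    of means applies. *)
Lemma herm_proj_overlap (P Q : 'M[C]_D) w (c : R) :
  P^t* = P -> P *m P = P -> Q^t* = Q -> Q *m Q = Q -> 0 <= c <= 2^-1 ->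
  w *m P *m Q *m P = c%:C%C *: (w *m P) ->
  rdot (w *m P) (w *m Q)
    <= 5 / 7 / 2 * (sqnorm (w *m P) + sqnorm (w *m Q)).
Proof.
move=> hP iP hQ iQ c2 PQP.
have e : sqnorm (w *m P *m Q) = c * sqnorm (w *m P).
  rewrite /sqnorm -(rdot_herm_proj (w *m P) (w *m P) hQ iQ).
  by rewrite rdotC rdot_adjoint hP rdotC PQP rdotZl -(rdot_herm_proj w w hP iP).
have r : rdot (w *m P) (w *m Q) = rdot (w *m P *m Q) (w *m Q).
  by rewrite rdotC (rdot_herm_proj w (w *m P) hQ iQ) rdotC.
have t75 : 0 < 7 / 5 :> R by rewrite divr_gt0 ?ltr0n.
apply: (overlap_le c2 (sqnorm_ge0 _) e _ (sqnorm_ge0 _)).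
by rewrite r; apply: rdot_le.
Qed.

(* Two merged slots sharing the slot t overlap by at most sqrt c <= 5/7. *)
Lemma projections_overlap t a b W z ya yb w (c : R) :
  W != 0 -> unitary_family t -> unitary_family a -> unitary_family b ->
  commuting a t -> commuting b t -> commuting a b ->
  class_scalar t W z -> class_scalar a W ya -> class_scalar b W yb ->
  mean_square z = c%:C%C -> 0 <= c <= 2^-1 -> (w <= W)%MS ->
  rdot (w *m average (slot_mul a t)) (w *m average (slot_mul b t))
    <= (5 / 7) / 2 * (sqnorm (w *m average (slot_mul a t))
                      + sqnorm (w *m average (slot_mul b t))).
Proof.
move=> W0 tF aF bF at_ bt ab Wz Wa Wb zc c2 wW.
have PF := family_slot_mul aF tF at_; have QF := family_slot_mul bF tF bt.
have nonneg x : 0 <= 5 / 7 / 2 * (sqnorm x + 0) :> R.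
  by rewrite addr0 !mulr_ge0 ?invr_ge0 ?ler0n ?sqnorm_ge0.
have [WQ0 | WQ0] := eqVneq (W *m average (slot_mul b t)) 0.
  have -> : w *m average (slot_mul b t) = 0.
    by have /submxP[E ->] := wW; rewrite -mulmxA WQ0 mulmx0.
  rewrite [sqnorm 0](@sqnorm0 R D) rdotC (@rdot0l R D); exact: nonneg.
(* A nonzero projection forces [b] to be dual to [t], which identifies the scalar of
   [average_average] with the mean square of [z]. *)
have yz := class_scalar_dual bF tF bt Wb Wz WQ0.
have zJ := class_scalarJ W0 Wz.
have ba : commuting b a by rewrite commuting_sym.
apply: (herm_proj_overlap (average_adjoint PF) (average_idem PF)
  (average_adjoint QF) (average_idem QF) c2).
have /submxP[E ->] := wW; rewrite -!(mulmxA E).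
rewrite (average_average aF tF at_ ba bt zJ Wb Wz) -scalemxAr -zc; congr (_ *: _).
by congr (_ * _); apply: eq_bigr => h _; rewrite yz.
Qed.

Definition dual_on W t a : bool := `[< forall g, W *m a g *m t g = W >].

(** The merged slot acts by the product of two characters, and this product is nontrivial. *)
Lemma average_linear W t a y z : (forall g, W *m a g = y g *: W) ->
  (forall g, W *m t g = z g *: W) -> unitary_family a -> unitary_family t ->
  commuting a t -> ~~ dual_on W t a -> W *m average (slot_mul a t) = 0.
Proof.
move=> Wa Wt aF tF at_ nd; have PF := family_slot_mul aF tF at_.
have [g ng] : exists g, W *m a g *m t g != W.
  apply: contrapT => no; move/negP: nd; apply; apply/asboolP => g.
  by apply/eqP/negPn/negP => ng; apply: no; exists g.
have e : W *m average (slot_mul a t)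
    = (y g * z g) *: (W *m average (slot_mul a t)).
  rewrite -{1}(mul_average g PF) mulmxA slot_mulE mulmxA Wa -scalemxAl Wt.
  by rewrite scalerA scalemxAl.
have yz : y g * z g != 1.
  apply: contraNneq ng => yz.
  by rewrite Wa -scalemxAl Wt scalerA yz scale1r.
apply/eqP; have := congr1 (fun A => A - (y g * z g) *: (W *m average (slot_mul a t))) e.
rewrite subrr -{1}[W *m _]scale1r -scalerBl => /eqP.
by rewrite scaler_eq0 subr_eq0 eq_sym (negPf yz).
Qed.

(* If every slot had more than half of the slots dual to it, all slots would act
   through one character equal to its own inverse. *)
Lemma few_duals K s W (z : opfun -> gT -> C) : W != 0 -> (0 < K)%N ->
  invariant_free s W -> order_two_deficit K s W ->
  {in s, forall t, {morph z t : x y / (x * y)%g >-> x * y}} ->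
  {in s, forall t g, W *m t g = z t g *: W} -> (0 < size s)%N ->
  exists2 t, t \in s & (2 * count (dual_on W t) s <= size s)%N.
Proof.
move=> W0 K0 [fam _ _ av0] [Ks def] zM Wz s0; apply: contrapT => no.
have big t : t \in s -> (size s < 2 * count (dual_on W t) s)%N.
  by move=> ts; rewrite ltnNge; apply/negP => h; apply: no; exists t.
have dual t b : t \in s -> b \in s -> dual_on W t b -> forall g, z b g * z t g = 1.
  move=> ts bs /asboolP h g; apply: (scale_inj W0); rewrite scale1r -{2}(h g).
  by rewrite Wz // -scalemxAl Wz // scalerA.
(* Two sets that each contain more than half of the slots meet. *)
have common t a : t \in s -> a \in s ->
    exists b, [/\ b \in s, dual_on W t b & dual_on W a b].
  move=> ts as_; have := count_predUI (dual_on W t) (dual_on W a) s.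
  have := count_size (predU (dual_on W t) (dual_on W a)) s.
  have := big t ts; have := big a as_ => h1 h2 h3 h4.
  have : (0 < count (predI (dual_on W t) (dual_on W a)) s)%N.
    by move: h1 h2 h3 h4; clear; lia.
  rewrite -has_count => /hasP[b bs /andP[db1 db2]]; by exists b.
have same t a : t \in s -> a \in s -> forall g, z t g = z a g.
  move=> ts as_ g; have [b [bs bt ba]] := common t a ts as_.
  have e1 := dual t b ts bs bt g; have e2 := dual a b as_ bs ba g.
  have zb : z b g != 0 by apply: contra_eq_neq e1 => ->; rewrite mul0r eq_sym oner_neq0.
  by apply: (mulfI zb); rewrite e1 e2.
have [t ts] : exists t, t \in s.
  case: s s0 {fam av0 Ks def zM Wz no big dual common same} => // a s _.
  by exists a; rewrite mem_head.
(* Some slot is dual to [t], and by [same] it acts by the character of [t] itself. *)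
have z2 g : z t g ^+ 2 = 1.
  have [b [bs bt _]] := common t t ts ts.
  by rewrite expr2 -{1}(same b t bs ts) (dual t b).
have chi2 : order_two_character (z t).
  split; [exact: zM | exact: z2 |].
  apply: contrapT => no1; move/eqP: W0; apply.
  rewrite -(av0 t ts); apply/esym/average_fix => g; rewrite Wz //.
  have [-> | ne] := eqVneq (z t g) 1; first by rewrite scale1r.
  by case: no1; exists g.
(* All slots carry this character, which contradicts a deficit [K > 0]. *)
have := def _ chi2; rewrite /multiplicity.
have -> : count (fun a => `[< occurs (z t) a W >]) s = size s.
  apply/eqP; rewrite -all_count; apply/allP => a as_; apply/asboolP.
  have [i rW] : exists i, row i W != 0.
    apply: contrapT => no1; move/eqP: W0; apply; apply/row_matrixP => i.
    rewrite row0; apply/eqP/negPn/negP => ni; by apply: no1; exists i.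
  exists (row i W); split=> // [|g]; first exact: row_sub.
  by rewrite -row_mul Wz // (same a t) // linearZ.
by move: K0; clear; lia.
Qed.

Lemma invariant_free_front s t W : t \in s -> invariant_free s W ->
  exists s', perm_eq s (t :: s') /\ forall X, injsum s X = injsum (t :: s') X.
Proof.
move=> ts [_ pw _ _]; exists (delete s (index t s)).
have js : (index t s < size s)%N by rewrite index_mem.
split; first by have := perm_delete t js; rewrite nth_index.
by move=> X; rewrite (injsum_delete t X js pw) nth_index.
Qed.

(** The slot put in front decides. One with mean square at most [1 / 2] gives [kappa = 1 + 5 p / 7]
    by overlap; if there is none, all slots act by characters, and one with few duals gives
    [kappa = (p + 2) / 2]. *)
Lemma injsum_scalar_bound K p s W :
  size s = p.+2 -> (3 * p.+2 <= n)%N -> (0 < K)%N ->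
  @injsum_bounded R gT D p -> @injsum_bounded R gT D p.+1 ->
  W != 0 -> invariant_free s W -> order_two_deficit K s W -> scalar_on s W ->
  forall w, (w <= W)%MS ->
  sqnorm (w *m injsum s (finset.set0 : {set gT})) <= sq_bound R gT p.+2 K * sqnorm w.
Proof.
move=> ss hn K0 IHp IHp1 W0 good def sc w wW.
have [z hz] := scalar_choice sc; have [fam pw stab av0] := good.
have x0 : 0 <= p%:R :> R by apply: ler0n.
have hN : 2 * p%:R + 6 <= (n - p)%:R :> R.
  by rewrite -natrM -natrD ler_nat; move: hn; clear; lia.
have N1 : 0 <= ((n - p)%:R - 1) * (p%:R + 2) :> R.
  by apply: mulr_ge0; move: hN x0; clear; lra.
have Sp : p.+1%:R = p%:R + 1 :> R by rewrite -natr1.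
have SSp : p.+2%:R = p%:R + 2 :> R by rewrite -addn2 natrD.
have step t s' (kappa : R) : perm_eq s (t :: s') ->
    (forall X, injsum s X = injsum (t :: s') X) ->
    \sum_(j < size s') sqnorm (w *m average (slot_mul (nth t s' j) t))
      <= kappa * sqnorm w ->
    (p%:R + 1) ^+ 2 + ((n - p)%:R - (p%:R + 1)) * kappa
      <= (99 / 100) ^+ 4 * ((n - p)%:R - 1) * (p%:R + 2) ->
    sqnorm (w *m injsum s (finset.set0 : {set gT})) <= sq_bound R gT p.+2 K * sqnorm w.
  move=> pe -> hk hnum; have := perm_size pe; rewrite ss => -[ss'].
  apply: (injsum_step (kappa := kappa) _ hn IHp IHp1 _ _ wW hk) => //.
  - exact: invariant_free_perm pe good.
  - exact: order_two_deficit_perm pe def.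
  by rewrite Sp SSp -mulrA; apply: deficit_exponent; rewrite // mulrA.
have [[t [ts [c zc c2]]] | no] := pselect (exists t, t \in s /\
    exists2 c : R, mean_square (z t) = c%:C%C & 0 <= c <= 2^-1).
  have [s' [pe es]] := invariant_free_front ts good.
  have ss' : size s' = p.+1 by have := perm_size pe; rewrite ss => -[].
  have [fam' pw' _ _] := invariant_free_perm pe good.
  move: pw'; rewrite pairwise_cons => /andP[ts' pw'].
  have s'F j : (j < size s')%N -> nth t s' j \in s.
    by move=> js; rewrite (perm_mem pe) in_cons mem_nth ?orbT.
  have s't j : (j < size s')%N -> commuting (nth t s' j) t.
    by move=> js; rewrite commuting_sym (allP ts') ?mem_nth.
  apply: (step t s' (1 + p%:R * (5 / 7)) pe es); last exact: overlap_scalar.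
  apply: (@sum_sqnorm_projections R D _
    (fun j : 'I_(size s') => average (slot_mul (nth t s' j) t)) w (5 / 7)).
  - move=> j; apply: average_adjoint; apply: family_slot_mul (s't j _) => //.
      exact/fam/s'F.
    exact: fam.
  - move=> j; apply: average_idem; apply: family_slot_mul (s't j _) => //.
      exact/fam/s'F.
    exact: fam.
  - move=> i j ij.
    have tF := fam t ts; have iF := fam _ (s'F i (ltn_ord i)).
    have jF := fam _ (s'F j (ltn_ord j)).
    have ij_com : commuting (nth t s' i) (nth t s' j).
      have /(pairwiseP t) pwP := pw'.
      have [lt_ij | lt_ji] := ltnP i j; first by apply: pwP; rewrite ?inE.
      rewrite commuting_sym; apply: pwP; rewrite ?inE // ltn_neqAle lt_ji andbT.
      by rewrite eq_sym.
    exact: (projections_overlap W0 tF iF jF (s't i _) (s't j _) ij_com (hz t ts)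
      (hz _ (s'F i _)) (hz _ (s'F j _)) zc c2 wW).
  - by rewrite ltr_wpDr ?ltr01 // !mulr_ge0 ?invr_ge0 ?ler0n.
  by rewrite card_ord ss' Sp addrK.
have lin : {in s, forall t, {morph z t : x y / (x * y)%g >-> x * y}
    /\ forall g, W *m t g = z t g *: W}.
  move=> t ts; have [sm | //] := scalar_dichotomy W0 (fam t ts) (hz t ts).
  by case: no; exists t.
have s0 : (0 < size s)%N by rewrite ss.
have zM t (ts : t \in s) := (lin t ts).1; have Wz t (ts : t \in s) := (lin t ts).2.
have [t ts few] := few_duals W0 K0 good def zM Wz s0.
have [s' [pe es]] := invariant_free_front ts good.
have ss' : size s' = p.+1 by have := perm_size pe; rewrite ss => -[].
have [_ pw' _ _] := invariant_free_perm pe good.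
move: pw'; rewrite pairwise_cons => /andP[ts' _].
apply: (step t s' ((p%:R + 2) / 2) pe es); last by apply: overlap_half.
(* A slot not dual to [t] gives zero, so the sum of squared norms only counts duals. *)
have le_dual (j : 'I_(size s')) :
    sqnorm (w *m average (slot_mul (nth t s' j) t))
    <= (dual_on W t (nth t s' j))%:R * sqnorm w.
  have js : nth t s' j \in s by rewrite (perm_mem pe) in_cons mem_nth ?orbT.
  have jt : commuting (nth t s' j) t by rewrite commuting_sym (allP ts') ?mem_nth.
  have jF := fam _ js; have tF := fam t ts.
  have [d | nd] := boolP (dual_on W t (nth t s' j)); rewrite ?mul1r ?mul0r.
    have PF := family_slot_mul jF tF jt.
    rewrite [leRHS](sqnorm_herm_proj w (average_adjoint PF) (average_idem PF)).
    by rewrite lerDl sqnorm_ge0.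
  have /submxP[E ->] := wW.
  by rewrite -mulmxA (average_linear (Wz _ js) (Wz _ ts) jF tF jt nd) mulmx0 sqnorm0.
apply: (le_trans (ler_sum _ (fun j _ => le_dual j))).
rewrite -mulr_suml ler_wpM2r ?sqnorm_ge0 // -natr_sum.
have -> : (\sum_(j < size s') dual_on W t (nth t s' j) = count (dual_on W t) s')%N.
  rewrite -sum1_count [RHS]big_mkcond (big_nth t) big_mkord.
  by apply: eq_bigr => j _; case: ifP.
have := seq.permP pe (dual_on W t) => /= cnt.
have le2 : (2 * count (dual_on W t) s' <= p.+2)%N.
  by move: few cnt; rewrite ss; clear; lia.
rewrite ler_pdivlMr ?ltr0n // -SSp -natrM ler_nat mulnC.
exact: le2.
Qed.

End ScalarCase.

(** * The bound for any number of slots, and removal of trivial slots *)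

Section InjsumBound.

Variables (R : rcfType) (gT : finGroupType) (D : nat).
Local Notation C := R[i].
Local Notation opfun := {ffun gT -> 'M[C]_D}.
Local Notation n := #|{: gT}|.

Lemma sq_bound_ge0 m K : 0 <= sq_bound R gT m K.
Proof.
by rewrite /sq_bound !mulr_ge0 ?exprn_ge0 ?ler0n // mulr_ge0 ?invr_ge0 ?ler0n.
Qed.

(** Merging leads from [p.+2] slots to [p.+1] and to [p], hence two base cases. With one slot the
    sum is a multiple of its average, zero on [W]. *)
Lemma injsum_bound m : (3 * m <= n)%N -> @injsum_bounded R gT D m.
Proof.
have [k] := ubnP m; elim: k m => // k IH [|[|p]] mk hn K s W sm good def w wW.
- have [Ks _] := def; move: Ks sm; case: s {good def} => // K0 _ /=.
  have -> : K = 0%N by move: K0; clear; rewrite /=; lia.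
  by rewrite mulmx1 /sq_bound muln0 expr0 ffactn0 !mul1r.
- case: s sm good def => [|t [|]] // _ [_ _ _ av0] _ /=.
  under eq_bigr do rewrite mulmx1.
  have -> : \sum_(x | x \notin (finset.set0 : {set gT})) t x = n%:R *: average t.
    rewrite averageE scalerA mulfV ?card_neq0 // scale1r.
    by apply: eq_bigl => x; rewrite finset.in_set0.
  have /submxP[B ->] := wW.
  rewrite -scalemxAr -mulmxA av0 ?mem_head // mulmx0 scaler0 sqnorm0.
  by rewrite mulr_ge0 ?sq_bound_ge0 ?sqnorm_ge0.
have IHp : @injsum_bounded R gT D p by apply: IH; move: mk hn; clear; lia.
have IHp1 : @injsum_bounded R gT D p.+1 by apply: IH; move: mk hn; clear; lia.
case: (posnP K) => [K0 | K0]; last first.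
  apply: (scalar_reduction good) wW => W' sub W'0 good' sc v vW'.
  apply: (injsum_scalar_bound sm hn K0 IHp IHp1 W'0 good' _ sc vW').
  exact: order_two_deficit_sub def.
(* For [K = 0] no gain is required: projections are contractions, so [kappa] may be the number of
   terms. *)
rewrite {}K0 in def *; case: s sm good def => // t s [ss] good def.
have [fam pw _ _] := good; move: pw; rewrite pairwise_cons => /andP[ts _].
apply: (injsum_step (kappa := p.+1%:R) ss hn IHp IHp1 good def wW).
  rewrite -ss mulr_natl -[X in _ *+ X](card_ord (size s)) -sumr_const.
  apply: ler_sum => j _.
  have tF : unitary_family t by apply: fam; rewrite mem_head.
  have jF : unitary_family (nth t s j) by apply: fam; rewrite in_cons mem_nth ?orbT.
  have jt : commuting (nth t s j) t by rewrite commuting_sym (allP ts) ?mem_nth.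
  have PF := family_slot_mul jF tF jt.
  rewrite [leRHS](sqnorm_herm_proj w (average_adjoint PF) (average_idem PF)).
  by rewrite lerDl sqnorm_ge0.
rewrite expr0 mul1r.
have -> : p.+1%:R = p%:R + 1 :> R by rewrite -natr1.
have -> : p.+2%:R = p%:R + 2 :> R by rewrite -addn2 natrD.
apply: overlap_trivial; first exact: ler0n.
by rewrite -natrM -natrD ler_nat; move: hn; clear; lia.
Qed.

Lemma injsum_perm s s' (X : {set gT}) : perm_eq s s' ->
  pairwise (@commuting C gT D) s -> injsum s X = injsum s' X.
Proof.
elim: s' s X => [|t s' IH] s X pe pw; first by rewrite (perm_nilP pe).
have ts : t \in s by rewrite (perm_mem pe) mem_head.
have js : (index t s < size s)%N by rewrite index_mem.
have := perm_delete t js; rewrite nth_index // => pd.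
have pd' : perm_eq (delete s (index t s)) s'.
  by rewrite -(perm_cons t); apply: perm_trans pe; rewrite perm_sym.
rewrite (injsum_delete t X js pw) nth_index //.
move: pw; rewrite (perm_pairwise_commuting pd) pairwise_cons => /andP[_ pw'].
by apply: injsum_cons => Y; apply: IH.
Qed.

(** Each trivial slot multiplies by the number of values that the slots behind it leave free; the
    factors form a falling factorial. *)
Lemma injsum_trivial_slots (l s : seq opfun) :
  (forall t, t \in l -> forall g, t g = 1%:M) -> pairwise (@commuting C gT D) (l ++ s) ->
  (size l + size s <= n)%N ->
  injsum (l ++ s) (finset.set0 : {set gT})
    = ((n - size s) ^_ (size l))%:R *: injsum s finset.set0.
Proof.
elim: l => [|t l IH] l1 pw le; first by rewrite ffactn0 scale1r.
move: pw le; rewrite cat_cons pairwise_cons => /andP[tls pw] le.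
rewrite -[LHS]mul1mx (injsum_trivial _ tls pw) => [|g]; last first.
  by rewrite l1 ?mem_head // mulmx1.
rewrite mul1mx IH //; last first.
- by move: le => /=; clear; lia.
- by move=> a al; apply: l1; rewrite in_cons al orbT.
rewrite scalerA -natrB; last first.
  by rewrite finset.setC0 finset.cardsT size_cat; move: le => /=; clear; lia.
rewrite -natrM; congr (_%:R *: _).
rewrite finset.setC0 finset.cardsT size_cat /= ffactnSr mulnC.
by congr (_ * _)%N; clear; lia.
Qed.

End InjsumBound.

(** * The slots of a tensor product *)

Section TensorSlots.

Variables (R : rcfType) (gT : finGroupType) (n : nat) (d : 'I_n -> nat).
Variable rho : forall i : 'I_n, mx_representation R[i] [set: gT]%G (d i).
Local Notation C := R[i].
Local Notation D := (tensor_dim d).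

Definition at_slot (i : 'I_n) (g : gT) : power_group gT n :=
  [ffun j => if j == i then g else 1%g].

Definition slot (i : 'I_n) : {ffun gT -> 'M[C]_D} :=
  [ffun g => tensor_mx rho (at_slot i g)].

Lemma tensor_mxM x y : tensor_mx rho (x * y)%g = tensor_mx rho x *m tensor_mx rho y.
Proof. by have [_ ->] := tensor_mx_repr rho; rewrite ?inE. Qed.

Lemma tensor_mx1 : tensor_mx rho 1%g = 1%:M.
Proof. by have [->] := tensor_mx_repr rho. Qed.

Lemma tensor_mx_adjoint x : (forall i, unitary_repr (rho i)) ->
  (tensor_mx rho x)^t* = tensor_mx rho x^-1%g.
Proof.
move=> rhoU; have rhoV i g : rho i g^-1%g = (rho i g)^t*.
  rewrite -[LHS](mulmxtVK _ (rhoU i g (finset.in_setT g))) -repr_mxM ?inE //.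
  by rewrite mulVg repr_mx1 mul1mx.
apply/matrixP => a b; rewrite !mxE rmorph_prod.
by apply: eq_bigr => i _; rewrite invg_ffun rhoV !mxE.
Qed.

Lemma slot_unitary i : (forall i, unitary_repr (rho i)) -> unitary_family (slot i).
Proof.
move=> rhoU; split=> [g h | g]; rewrite !ffunE.
  rewrite -tensor_mxM; congr (tensor_mx _ _); apply/ffunP => j.
  by rewrite mulg_ffun !ffunE; case: eqP; rewrite ?mulg1.
by apply/unitarymxP; rewrite tensor_mx_adjoint // -tensor_mxM mulgV tensor_mx1.
Qed.

Lemma slot_commuting i j : i != j -> commuting (slot i) (slot j).
Proof.
move=> ij; apply/commutingP => g h; rewrite !ffunE -!tensor_mxM.
congr (tensor_mx _ _); apply/ffunP => k; rewrite !mulg_ffun !ffunE.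
case: (eqVneq k i) => [-> | _]; first by rewrite (negPf ij) mulg1 mul1g.
by case: eqP; rewrite ?mulg1 ?mul1g.
Qed.

Lemma slots_commuting (l : seq 'I_n) : uniq l ->
  pairwise (@commuting C gT D) (map slot l).
Proof.
rewrite uniq_pairwise pairwise_map; apply: sub_pairwise => i j /=.
exact: slot_commuting.
Qed.

(** Coordinates outside [l] are pinned to 1, so that a choice of values in [l] is a single element
    of the power group. *)
Definition injective_tuple (l : seq 'I_n) (X : {set gT}) (x : power_group gT n) :=
  [&& uniq [seq x i | i <- l], all (fun g => g \notin X) [seq x i | i <- l]
    & [forall i, (i \in l) || (x i == 1%g)]].

Lemma injsum_slots (l : seq 'I_n) (X : {set gT}) : uniq l ->
  injsum (map slot l) X = \sum_(x | injective_tuple l X x) tensor_mx rho x.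
Proof.
elim: l X => [|i l IH] X /=.
  move=> _; rewrite (big_pred1 (1%g : power_group gT n)) ?tensor_mx1 // => x.
  rewrite /injective_tuple /=; apply/forallP/eqP => [h | -> j]; last by rewrite oneg_ffun.
  by apply/ffunP => j; rewrite oneg_ffun; apply/eqP/h.
move=> /andP[il ul].
under eq_bigr => g _ do rewrite ffunE IH // mulmx_sumr.
rewrite pair_big_dep /=.
(* [glue] inserts a value in the coordinate [i] and [cut] takes it out; they are mutually inverse on
   pairs with [x i = 1]. *)
pose glue (p : gT * power_group gT n) : power_group gT n := (at_slot i p.1 * p.2)%g.
pose cut (y : power_group gT n) : gT * power_group gT n :=
  (y i, [ffun j => if j == i then 1%g else y j]).
have cutK y : glue (cut y) = y.
  apply/ffunP => j; rewrite mulg_ffun !ffunE; case: eqP => [-> | _].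
    by rewrite mulg1.
  by rewrite mul1g.
rewrite [RHS](reindex_onto glue cut) //=.
apply: eq_big => [[g x] | [g x] _] /=; last by rewrite tensor_mxM.
have gl j : glue (g, x) j = if j == i then (g * x i)%g else x j.
  by rewrite mulg_ffun !ffunE; case: eqP => [-> | _]; rewrite ?mul1g.
have -> : (cut (glue (g, x)) == (g, x)) = (x i == 1%g).
  rewrite /cut xpair_eqE gl eqxx; apply/andP/eqP => [[_ /eqP/ffunP/(_ i)] | xi].
    by rewrite ffunE eqxx.
  rewrite xi mulg1 eqxx; split=> //; apply/eqP/ffunP => j.
  by rewrite ffunE gl; case: eqP => [-> | ].
have maps : [seq glue (g, x) j | j <- l] = [seq x j | j <- l].
  apply/eq_in_map => j jl; rewrite gl; case: eqP => // ji.
  by move: il; rewrite -ji jl.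
rewrite /injective_tuple /= maps gl eqxx.
have -> : all (fun a => a \notin g |: X) [seq x j | j <- l]
    = (g \notin [seq x j | j <- l]) && all (fun a => a \notin X) [seq x j | j <- l].
  elim: [seq x j | j <- l] => //= a r ->; rewrite in_setU1 in_cons !negb_or eq_sym.
  by rewrite -!andbA; do !bool_congr.
have [xi | xi] := eqVneq (x i) 1%g; last first.
  rewrite andbF; apply/negbTE; rewrite !negb_and; apply/orP; right; apply/orP; right.
  by apply/orP; right; apply/forallPn; exists i; rewrite (negPf il) (negPf xi).
have -> : [forall j, (j \in i :: l) || (glue (g, x) j == 1%g)]
    = [forall j, (j \in l) || (x j == 1%g)].
  apply: eq_forallb => j; rewrite in_cons gl; case: (eqVneq j i) => [-> | _] //=.
  by rewrite xi eqxx orbT.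
rewrite xi mulg1 andbT; case: (g \notin X); case: (g \notin [seq x j | j <- l]) => //=;
  by rewrite ?andbF ?andbT.
Qed.

Lemma sum_distinct_tuples :
  \sum_(x in distinct_tuples gT n) tensor_mx rho x
    = injsum (map slot (enum 'I_n)) (finset.set0 : {set gT}).
Proof.
rewrite injsum_slots ?enum_uniq //; apply: eq_bigl => x; rewrite inE.
rewrite /injective_tuple; have -> : all (fun g => g \notin (finset.set0 : {set gT}))
    [seq x i | i <- enum 'I_n].
  by apply/allP => g _; rewrite finset.in_set0.
have -> : [forall i, (i \in enum 'I_n) || (x i == 1%g)].
  by apply/forallP => i; rewrite mem_enum.
by rewrite !andbT.
Qed.

Lemma slot_trivial i : mx_rsim (rho i) (triv_repr C gT) -> forall g, slot i g = 1%:M.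
Proof.
case=> B _ freeB hB g; have r1 : rho i g = 1%:M.
  apply: (row_free_inj freeB); rewrite /= hB ?inE //.
  by rewrite mulmx1 mul1mx.
rewrite ffunE -tensor_mx1; apply/matrixP => a b; rewrite !mxE.
apply: eq_bigr => j _; rewrite oneg_ffun repr_mx1 ffunE; case: eqP => [ji | _].
  by rewrite ji r1.
by rewrite repr_mx1.
Qed.

(* The slice of w through a fixed multi-index b in the direction i. *)
Lemma slot_eigenvector i (chi : gT -> C) (w : 'rV[C]_D) : w != 0 ->
  (forall g, w *m slot i g = chi g *: w) ->
  exists2 u : 'rV[C]_(d i), u != 0 & forall g, u *m rho i g = chi g *: u.
Proof.
move=> w0 hw; have [b wb] : exists b : tensor_index d, w 0 (enum_rank b) != 0.
  apply: contrapT => no; move/eqP: w0; apply; apply/rowP => k; rewrite mxE.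
  apply/eqP/negPn/negP => wk; apply: no; exists (enum_val k).
  by rewrite enum_valK.
pose upd (c : tensor_index d) (j : 'I_(d i)) : tensor_index d :=
  [ffun k => dfwith c j k].
have updi c j : upd c j i = j by rewrite ffunE dfwith_in.
have updo c j k : i != k -> upd c j k = c k by move=> ik; rewrite ffunE dfwith_out.
exists (\row_j w 0 (enum_rank (upd b j))).
  apply/negP => /eqP/rowP/(_ (b i)); rewrite !mxE.
  have -> : upd b (b i) = b.
    apply/ffunP => k; have [<- | ik] := eqVneq i k; first by rewrite updi.
    by rewrite updo.
  by move/eqP; rewrite (negPf wb).
move=> g; apply/rowP => l; have := congr1 (fun v : 'rV_D => v 0 (enum_rank (upd b l))) (hw g).
rewrite !mxE => <-.
rewrite (reindex (fun c : tensor_index d => enum_rank c)) /=; last first.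
  exact/onW_bij/enum_rank_bij.
(* The other factors are identities, so this column is supported on the multi-indices that agree
   with [b] off [i]. *)
have entry c : slot i g (enum_rank c) (enum_rank (upd b l))
    = if upd b (c i) == c then rho i g (c i) l else 0.
  rewrite ffunE mxE !enum_rankK; case: eqP => [e | ne].
    rewrite (bigD1 i) //= updi ffunE eqxx big1 ?mulr1 // => k ki.
    have ik : i != k by rewrite eq_sym.
    by rewrite ffunE (negPf ki) repr_mx1 mxE -e !updo // eqxx.
  have [k [ik ck]] : exists k, i != k /\ c k != b k.
    apply: contrapT => no; apply: ne; apply/ffunP => k.
    have [<- | ik] := eqVneq i k; first by rewrite updi.
    rewrite updo //; apply/eqP/negPn/negP => cb; apply: no; exists k.
    by split=> //; rewrite eq_sym.
  have ki : k != i by rewrite eq_sym.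
  by rewrite (bigD1 k) //= ffunE (negPf ki) repr_mx1 mxE updo // (negPf ck) mul0r.
under [RHS]eq_bigr => c _ do rewrite entry.
rewrite [RHS](bigID (fun c : tensor_index d => upd b (c i) == c)) /= [X in _ + X]big1 ?addr0; last first.
  by move=> c /negPf ->; rewrite mulr0.
rewrite (reindex_onto (upd b) (fun c : tensor_index d => c i)) /=; last first.
  by move=> c /eqP.
rewrite [RHS](eq_bigl xpredT) => [|j]; last by rewrite !updi !eqxx.
by apply: eq_bigr => j _; rewrite !updi eqxx mxE.
Qed.

(** The line of [u] is a submodule, hence the whole space, and [u] itself is the intertwiner. *)
Lemma irreducible_line k (r : mx_representation C [set: gT]%G k)
    (r1 : mx_representation C [set: gT]%G 1) (chi : gT -> C) (u : 'rV[C]_k) :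
  mx_irreducible r -> (forall g, r1 g = (chi g)%:M) ->
  u != 0 -> (forall g, u *m r g = chi g *: u) -> mx_rsim r r1.
Proof.
move=> [_ _ irr] r1E u0 hu; apply: mx_rsim_sym.
have full : (1%:M <= <<u>>)%MS.
  apply: irr; rewrite ?submx1 //; last by rewrite -mxrank_eq0 genmxE mxrank_eq0.
  rewrite (eqmx_module _ (genmxE u)); apply/mxmoduleP => g _.
  by rewrite hu scalemx_sub.
have ru : \rank u = 1%N by rewrite rank_rV u0.
have k1 : 1%N = k.
  apply/eqP; rewrite eqn_leq -{1}ru rank_leq_col /= -[X in (X <= _)%N](mxrank1 C k).
  by apply: leq_trans (mxrankS full) _; rewrite genmxE ru.
exists u => //; first by rewrite /row_free ru.
by move=> g _; rewrite r1E hu mul_scalar_mx.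
Qed.

(** A nonzero row of the average would be an invariant vector; a slice of it would be invariant
    under [rho i] and make [rho i] trivial. *)
Lemma slot_average_eq0 i : mx_irreducible (rho i) -> nontrivial_repr (rho i) ->
  (forall i, unitary_repr (rho i)) -> average (slot i) = 0.
Proof.
move=> irr nt rhoU; apply: contrapT => ne; apply: nt.
have [k ke] : exists k, row k (average (slot i)) != 0.
  apply: contrapT => no; apply: ne; apply/row_matrixP => k; rewrite row0.
  by apply/eqP/negPn/negP => nk; apply: no; exists k.
have [|u u0 hu] := slot_eigenvector (i := i) (chi := fun=> 1) ke.
  by move=> g; rewrite -row_mul average_mul ?scale1r //; apply: slot_unitary.
exact: irreducible_line irr _ u0 hu.
Qed.

Lemma slot_occurs i chi (W : 'M[C]_D) (r1 : mx_representation C [set: gT]%G 1) :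
  mx_irreducible (rho i) -> (forall g, r1 g = (chi g)%:M) ->
  occurs chi (slot i) W -> mx_rsim (rho i) r1.
Proof.
move=> irr r1E [w [_ w0 hw]]; have [u u0 hu] := slot_eigenvector w0 hw.
exact: irreducible_line irr r1E u0 hu.
Qed.

End TensorSlots.

(** * Order two characters as representations *)

Section OrderTwo.

Variables (C : numClosedFieldType) (gT : finGroupType).

Lemma linear_mx_repr (chi : gT -> C) :
  {morph chi : x y / (x * y)%g >-> x * y} -> (forall g, chi g ^+ 2 = 1) ->
  mx_repr [set: gT] (fun g => (chi g)%:M : 'M[C]_1).
Proof.
move=> chiM chi2; split=> [|x y _ _]; last by rewrite chiM scalar_mxM.
congr (_%:M); have c0 : chi 1%g != 0.
  by apply: contra_eq_neq (chi2 1%g) => ->; rewrite expr0n eq_sym oner_neq0.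
by apply: (mulfI c0); rewrite -chiM mulg1 mulr1.
Qed.

Lemma order_two_repr_exists (chi : gT -> C) :
  {morph chi : x y / (x * y)%g >-> x * y} -> (forall g, chi g ^+ 2 = 1) ->
  (exists g, chi g != 1) ->
  exists r : mx_representation C [set: gT]%G 1,
    [/\ forall g, r g = (chi g)%:M, unitary_repr r & order_two_repr r].
Proof.
move=> chiM chi2 [g0 ng0]; exists (MxRepresentation (linear_mx_repr chiM chi2)).
split=> // [g _ |].
  apply/unitarymxP => /=; rewrite tr_scalar_mx map_scalar_mx -scalar_mxM.
  have /orP[/eqP -> | /eqP ->] : (chi g == 1) || (chi g == -1).
    by rewrite -sqrf_eq1 chi2.
  - by rewrite /= rmorph1 mulr1.
  - by rewrite /= rmorphN rmorph1 mulrNN mulr1.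
split=> [|g]; last first.
  by rewrite /= expr2 -mulmxE -scalar_mxM -expr2 chi2.
case=> B _ freeB hB; move/eqP: ng0; apply.
have : (chi g0)%:M = 1%:M :> 'M[C]_1.
  by apply: (row_free_inj freeB); have := hB g0 (finset.in_setT g0); rewrite /= mulmx1 mul1mx.
by move/matrixP/(_ 0 0); rewrite !mxE.
Qed.

End OrderTwo.

(** * Operator norms and the final constant *)

Section OperatorNorm.

Variables (R : realType) (gT : finGroupType).
Local Notation C := R[i].

Lemma l2normE k (v : 'cV[C]_k) : l2norm v = Num.sqrt (sqnorm (v^t*)).
Proof.
congr (Num.sqrt _); rewrite /sqnorm rdotE; apply: eq_bigr => j _.
rewrite !mxE; case: (v j 0) => a b /=.
by rewrite sqr_sqrtr ?addr_ge0 ?sqr_ge0 // mulrNN !expr2.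
Qed.

(** Conjugate transposition passes from columns to rows, where [A] acts through its adjoint. *)
Lemma opnorm_le k (A : 'M[C]_k) (B : R) : 0 <= B ->
  (forall v : 'rV[C]_k, sqnorm (v *m A^t*) <= B ^+ 2 * sqnorm v) ->
  opnorm A <= B.
Proof.
move=> B0 hA; apply: ge_sup.
  exists (l2norm (A *m 0)), 0 => //=.
  by rewrite l2normE trmx0 map_mx0 sqnorm0 sqrtr0 ler01.
move=> _ /= [v v1 <-]; rewrite l2normE trmx_mul map_mxM.
rewrite -[leRHS](ger0_norm B0) -sqrtr_sqr ler_wsqrtr //.
apply: (le_trans (hA _)); rewrite -[leRHS]mulr1 ler_wpM2l ?sqr_ge0 //.
by move: v1; rewrite l2normE -[leRHS]sqrtr1 ler_sqrt ?ltr01.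
Qed.

(** The factorials combine to the square of [n!] over the binomial coefficient; since the base is
    below 1, [e <= K] lets the real exponent replace the integer one. *)
Lemma final_constant m n K (e : R) : #|{: gT}| = n -> (m <= n)%N -> e <= K%:R ->
  (((n - m)`!%:R / n%:R ^+ n) ^+ 2) * sq_bound R gT m K
  <= ((99 / 100) `^ e * 'C(n, m)%:R `^ (- 2^-1) * (n`!%:R / n%:R ^+ n)) ^+ 2.
Proof.
move=> card_G mn eK; rewrite /sq_bound card_G.
have b0 : 0 < 'C(n, m)%:R :> R by rewrite ltr0n bin_gt0.
have bb : ('C(n, m)%:R `^ (- 2^-1)) ^+ 2 = 'C(n, m)%:R^-1 :> R.
  by rewrite powRN exprVn powR12_sqrt ?ler0n // sqr_sqrtr ?ler0n.
have aa : (99 / 100) ^+ (2 * K) <= ((99 / 100) `^ e) ^+ 2 :> R.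
  rewrite mulnC exprM; have c1 : 0 < (99 / 100 : R) <= 1 by apply/andP; split; lra.
  apply: lerXn2r; rewrite ?nnegrE ?exprn_ge0 ?powR_ge0 //; first by lra.
  by rewrite -powR_mulrn; [apply: ger_powR | lra].
have e1 : n`!%:R = (n ^_ m)%:R * (n - m)`!%:R :> R by rewrite -natrM ffact_fact.
have e2 : (n ^_ m)%:R = 'C(n, m)%:R * m`!%:R :> R by rewrite -natrM bin_ffact.
have -> : ((n - m)`!%:R / n%:R ^+ n) ^+ 2 *
    ((99 / 100) ^+ (2 * K) * (n ^_ m)%:R * m`!%:R)
  = (99 / 100) ^+ (2 * K) * ('C(n, m)%:R^-1 * (n`!%:R / n%:R ^+ n) ^+ 2) :> R.
  rewrite e1 e2; move: b0 => /gt_eqF/negbT.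
  by move: ((n%:R ^+ n)^-1 : R) ('C(n, m)%:R : R) (m`!%:R : R) ((n - m)`!%:R : R)
    ((99 / 100) ^+ (2 * K) : R) => q c x y u c0; field.
rewrite [leRHS]exprMn [X in _ <= X * _]exprMn bb -[leRHS]mulrA ler_wpM2r //.
by apply: mulr_ge0; rewrite ?invr_ge0 ?sqr_ge0.
Qed.

End OperatorNorm.

Theorem theorem5p3 (R : realType) (gT : finGroupType) (n m : nat) (eps : R)
    (d : 'I_n -> nat)
    (rho : forall i : 'I_n, mx_representation R[i] [set: gT]%G (d i))
    (card_G : #|{: gT}| = n)
    (m_le : m%:R <= n%:R / 3 :> R)
    (eps_ge0 : 0 <= eps)
    (eps_le1 : (0 < m)%N -> eps <= 1)
    (rho_unitary : forall i : 'I_n, unitary_repr (rho i))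
    (rho_irr : forall i : 'I_n, mx_irreducible (rho i))
    (rho_sparse : #|supp_repr rho| = m)
    (order_two_le :
      forall rho0 : mx_representation R[i] [set: gT]%G 1,
        unitary_repr rho0 -> order_two_repr rho0 ->
        #|[set i in supp_repr rho | `[< mx_rsim (rho i) rho0 >]]%SET|%:R
          <= (1 - eps) * m%:R) :
  opnorm (fourier_distinct (tensor_repr rho))
    <= (99 / 100) `^ (eps * m%:R) * 'C(n, m)%:R `^ (- 2^-1)
       * (n`!%:R / n%:R ^+ n).
Proof.
pose S := enum (supp_repr rho); pose L := enum (~: supp_repr rho)%SET.
have sS : size S = m by rewrite -cardE.
have m3n : (3 * m <= n)%N.
  by rewrite -(ler_nat R) natrM mulrC -ler_pdivlMr ?ltr0n.
have mn : (m <= n)%N by move: m3n; clear; lia.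
have sL : size L = (n - m)%N.
  by rewrite -cardE cardsCs finset.setCK card_ord rho_sparse.
have x0 : 0 <= (1 - eps) * m%:R.
  case: (posnP m) => [-> | m0]; first by rewrite mulr0.
  by rewrite mulr_ge0 // subr_ge0 eps_le1.
have tr_le : (Num.truncn ((1 - eps) * m%:R))%:R <= (1 - eps) * m%:R :> R.
  by rewrite truncn_le.
have km : (Num.truncn ((1 - eps) * m%:R) <= m)%N.
  rewrite -(ler_nat R); apply: (le_trans tr_le).
  by rewrite ler_piMl // gerBl.
(* Multiplicities are integers, so the hypothesis bounds them by the truncation, and [K] is an
   integer at least [eps * m]. *)
pose K := (m - Num.truncn ((1 - eps) * m%:R))%N.
have eK : eps * m%:R <= K%:R.
  by rewrite natrB //; move: tr_le; move: (Num.truncn _) => T; clear; lra.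
(* Trivial slots go first; removing them yields the factor [(n - m)!]. *)
have SL : perm_eq (enum 'I_n) (L ++ S).
  apply: uniq_perm; first exact: enum_uniq.
    rewrite cat_uniq !enum_uniq andbT /=; apply/hasPn => i.
    by rewrite !mem_enum finset.in_setC => ->.
  by move=> i; rewrite mem_cat !mem_enum finset.in_setC orNb.
have T_eq : \sum_(x in distinct_tuples gT n) tensor_mx rho x
    = (n - m)`!%:R *: injsum (map (slot rho) S) (finset.set0 : {set gT}).
  rewrite sum_distinct_tuples.
  rewrite (injsum_perm _ (perm_map _ SL)); last exact/slots_commuting/enum_uniq.
  rewrite map_cat injsum_trivial_slots.
  - by rewrite !size_map sS sL card_G ffactnn.
  - move=> t /mapP[i iL ->]; apply: slot_trivial.
    move: iL; rewrite mem_enum finset.in_setC inE => /asboolPn/contrapT.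
    exact.
  - rewrite -map_cat; apply: slots_commuting.
    by rewrite -(perm_uniq SL) enum_uniq.
  - by rewrite !size_map sS sL card_G subnK.
(* Injective tuples are stable under inversion, so the Fourier coefficient is Hermitian and its
   action on rows controls the norm. *)
have A_adj : (fourier_distinct (tensor_repr rho))^t* = fourier_distinct (tensor_repr rho).
  rewrite /fourier_distinct linearZ /= map_mxZ /= fmorphV rmorphXn /= conjC_nat.
  congr (_ *: _); rewrite raddf_sum /= raddf_sum /=.
  rewrite [RHS](reindex_inj invg_inj) /=.
  apply: eq_big => [x | x _]; last by rewrite tensor_mx_adjoint.
  rewrite !inE; apply/injectiveP/injectiveP => h i j.
    by rewrite !invg_ffun => /invg_inj/h.
  by move=> e; apply: h; rewrite !invg_ffun e.
apply: opnorm_le.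
  by rewrite !mulr_ge0 ?powR_ge0 ?ler0n ?invr_ge0 ?exprn_ge0 ?ler0n.
move=> v; rewrite A_adj /fourier_distinct /= T_eq scalerA -scalemxAr.
have -> : n%:R ^- n * (n - m)`!%:R = (((n - m)`!%:R / n%:R ^+ n)%:C%C : R[i]).
  by rewrite mulrC rmorphM fmorphV rmorphXn /= !rmorph_nat.
rewrite sqnormZ.
have good : invariant_free (map (slot rho) S) 1%:M.
  split.
  - by move=> t /mapP[i _ ->]; apply: slot_unitary.
  - exact/slots_commuting/enum_uniq.
  - by move=> t _ g; apply: submx1.
  - move=> t /mapP[i iS ->]; rewrite slot_average_eq0 ?mulmx0 //.
    by move: iS; rewrite mem_enum inE => /asboolP.
have def : order_two_deficit K (map (slot rho) S) 1%:M.
  split=> [|chi [chiM chi2 chi1]]; rewrite size_map sS; first exact: leq_subr.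
  have [r [rE rU r2]] := order_two_repr_exists chiM chi2 chi1.
  have := order_two_le r rU r2; rewrite -truncn_ge_nat // => le_tr.
  (* A slot where [chi] occurs comes from a factor isomorphic to [r]. *)
  have le_mult : (multiplicity chi (map (slot rho) S) 1%:M
      <= #|[set i in supp_repr rho | `[< mx_rsim (rho i) r >]]%SET|)%N.
    rewrite /multiplicity count_map -size_filter cardE; apply: uniq_leq_size.
      by rewrite filter_uniq ?enum_uniq.
    move=> i; rewrite mem_filter /= !mem_enum => /andP[/asboolP occ iS].
    rewrite inE iS; apply/asboolP; exact: slot_occurs (rho_irr i) rE occ.
  by move: le_tr le_mult km; rewrite /K; clear; lia.
have m3 : (3 * m <= #|{: gT}|)%N by rewrite card_G.
have sS' : size (map (slot rho) S) = m by rewrite size_map.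
have := injsum_bound m3 sS' good def (submx1 v) => bound.
apply: (le_trans (ler_wpM2l (sqr_ge0 _) bound)); rewrite mulrA.
by rewrite ler_wpM2r ?sqnorm_ge0 // final_constant.
Qed.
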